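(* Let $A\subset\mathbb{T}=\mathbb{R}/\mathbb{Z}$ be Lebesgue measurable with measure $|A|$. Then there is a set $S\subseteq\mathbb{Z}$ of Beurling–Malliavin density $|A|$ such that if $f\in L^2(\mathbb{T})$ vanishes a.e. on $A$ and $\widehat f$ vanishes off $S$, then $f=0$ a.e. Indeed, let $\mathbf{P}^A$ be the determinantal probability measure on $2^{\mathbb{Z}}$ corresponding to the Toeplitz matrix $(j,k)\mapsto\widehat{\mathbf{1}_A}(k-j)$. Then $\mathbf{P}^A$-a.e. $S\subset\mathbb{Z}$ has this property (that is, has Beurling–Malliavin density $|A|$ and satisfies the stated uniqueness property).
   Context: $\mathbb{T}$ carries unit Lebesgue measure; $L^2(\mathbb{T})$ consists of complex-valued functions; $\widehat f(n):=\int_{\mathbb{T}} f(t)e^{-2\pi i n t}\,dt$ for $n\in\mathbb{Z}$. The determinantal probability measure corresponding to a matrix $Q=(Q_{j,k})_{j,k\in\mathbb{Z}}$ is the unique Borel probability measure on $2^{\mathbb{Z}}$ such that for all finite $F\subset\mathbb{Z}$ the probability that the random set contains $F$ is $\det(Q_{j,k})_{j,k\in F}$; it exists for the matrix in question. Beurling–Malliavin density: for an interval of integers $[a,b]\subset\mathbb{Z}\setminus\{0\}$, its aspect is $\alpha([a,b]):=\max\{|a|,|b|\}/\min\{|a|,|b|\}$. For $S\subseteq\mathbb{Z}$, the Beurling–Malliavin density of $S$ is the supremum of those $D\ge0$ for which there exist disjoint nonempty intervals $I_n\subset\mathbb{Z}\setminus\{0\}$ ($n\ge1$) with $|S\cap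 I_n|\ge D|I_n|$ for all $n$ and $\sum_{n\ge1}[\alpha(I_n)-1]^2=\infty$. *)

(* Defs.v *)
From HB Require Import structures.
From mathcomp Require Import all_boot all_order all_algebra finmap.
From mathcomp Require Import all_classical all_reals all_analysis.
From mathcomp Require Import complex.

Set Implicit Arguments.
Unset Strict Implicit.
Unset Printing Implicit Defensive.

Import Order.TTheory GRing.Theory Num.Theory.
Import numFieldNormedType.Exports.

Local Open Scope classical_set_scope.
Local Open Scope ring_scope.
Local Open Scope complex_scope.

(* The real line with its Lebesgue (not merely Borel) measurable sets: the
   sigma-algebra on which completed_lebesgue_measure lives. *)
Definition lebesgueType (R : realType) : measurableType _ :=
  caratheodory_type ((@wlength R idfun)^*)%mu.

(* T = R/Z is represented by the fundamental domain [0, 1[. A subset of T is a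
   subset of [0, 1[; a function on T is a function on the line of which only
   the values on [0, 1[ are ever used. *)
Definition torus (R : realType) : set (lebesgueType R) := `[0, 1[%classic.

Definition leb (R : realType) :
    {measure set (lebesgueType R) -> \bar R} :=
  @completed_lebesgue_measure R.

Definition is_L2 (R : realType) (f : lebesgueType R -> R[i]) : Prop :=
  [/\ measurable_fun (@torus R) (fun t => complex.Re (f t)),
      measurable_fun (@torus R) (fun t => complex.Im (f t)) &
      (\int[@leb R]_(t in @torus R) (Normc.normc (f t) ^+ 2)%:E < +oo)%E].

Definition torus_integral (R : realType) (f : lebesgueType R -> R[i]) : R[i] :=
  (\int[@leb R]_(t in @torus R) complex.Re (f t))%R +i*
  (\int[@leb R]_(t in @torus R) complex.Im (f t))%R.

Definition cis (R : realType) (x : R) : R[i] := cos x +i* sin x.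

Definition fourier (R : realType) (f : lebesgueType R -> R[i]) (n : int) :
    R[i] :=
  torus_integral (fun t : R => f t * cis (- (2 * pi * n%:~R * t))).

Definition charfun (R : realType) (A : set (lebesgueType R)) :
    lebesgueType R -> R[i] :=
  fun t => (\1_A t)%:C.

Definition toeplitz (R : realType) (A : set (lebesgueType R)) (j k : int) :
    R[i] :=
  fourier (charfun A) (k - j).

(* 2^Z with the product topology and its Borel sigma-algebra; S : powZ is the
   set of those n with S n = true. *)
Definition powZ : Type := prod_topology (fun _ : int => bool).
HB.instance Definition _ := Pointed.on powZ.
HB.instance Definition _ := Nbhs.on powZ.
HB.instance Definition _ := Topological.on powZ.

Definition borel_powZ : measurableType _ := g_sigma_algebraType (@open powZ).

Definition principal_minor (R : realType) (Q : int -> int -> R[i])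
    (F : {fset int}) : R[i] :=
  \det (\matrix_(i < size F, j < size F) Q (nth 0 F i) (nth 0 F j)).

Definition determinantal (R : realType) (Q : int -> int -> R[i])
    (P : probability borel_powZ R) : Prop :=
  forall F : {fset int},
    (fine (P [set S : powZ | forall k, k \in F -> S k]))%:C =
    principal_minor Q F.

Definition zitv (I : int * int) : set int := [set k | I.1 <= k <= I.2].

Definition aspect (R : realType) (I : int * int) : R :=
  (maxn `|I.1| `|I.2|)%:R / (minn `|I.1| `|I.2|)%:R.

Definition BM_admissible (R : realType) (S : powZ) (D : R) : Prop :=
  exists I : nat -> int * int,
    [/\ forall n, (I n).1 <= (I n).2 /\ ~ zitv (I n) 0,
        trivIset setT (fun n => zitv (I n)),
        forall n, D * (#|` fset_set (zitv (I n))|)%:R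
                  <= (#|` fset_set ([set k | S k] `&` zitv (I n))|)%:R &
        (\sum_(0 <= n <oo) ((aspect R (I n) - 1) ^+ 2)%:E = +oo)%E].

Definition BM_density (R : realType) (S : powZ) : \bar R :=
  ereal_sup [set D%:E | D in [set D : R | 0 <= D /\ BM_admissible S D]].

Definition uniqueness_set (R : realType) (A : set (lebesgueType R))
    (S : powZ) : Prop :=
  forall f : lebesgueType R -> R[i],
    is_L2 f ->
    {ae @leb R, forall t, A t -> f t = 0} ->
    (forall n : int, ~~ S n -> fourier f n = 0) ->
    {ae @leb R, forall t, torus t -> f t = 0}.

Definition good_spectrum (R : realType) (A : set (lebesgueType R))
    (S : powZ) : Prop :=
  BM_density R S = leb R A /\ uniqueness_set A S.

(* Main.v *)
(* Let Q be the Toeplitz matrix of 1_A. On a finite window, the probability that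
   the trace of the random set is C is the determinant of the matrix with rows of
   Q on C and rows of 1 - Q off C.

   Uniqueness: for k in C, the ratio P(C \ k) / P(C) is the squared norm of the
   out-of-window part of a function g that is supported on A, and whose Fourier
   coefficients on C vanish except for the one at k, which is 1. That ratio, as a
   function of the random C containing k, has mean at most 1, so almost surely it
   stays bounded along a sequence of windows that exhaust Z. Since f is orthogonal
   to each g, its coefficient at k is at most the square root of the ratio
   times the distance from f to the trigonometric polynomials of the window, and
   this distance tends to 0.

   Density: the generating function of the number of points among n given integers
   is det(1 + (z - 1) Q), which Hadamard's inequality bounds by
   (1 + (z - 1)|A|)^n; hence Chernoff bounds on both sides. Dyadic intervals and
   Borel-Cantelli give density at least |A|. For D > |A|, the sum of
   (aspect - 1)^2 over all intervals in which the density of the random set is at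
   least D has finite mean, so that no sequence of such intervals is
   admissible. *)
Require Import Defs.
From HB Require Import structures.
From mathcomp Require Import all_boot all_order all_algebra finmap.
From mathcomp Require Import all_classical all_reals all_analysis.
From mathcomp Require Import complex.
From mathcomp Require Import measurable_realfun perm ring lra zify.

Set Implicit Arguments.
Unset Strict Implicit.
Unset Printing Implicit Defensive.
Import Order.TTheory GRing.Theory Num.Theory.
Import numFieldNormedType.Exports.
Local Open Scope classical_set_scope.
Local Open Scope ring_scope.

(** * Determinants of mixed rows *)

(** About a finite block of Q the algebra uses only that it is Hermitian with eigenvalues in [0, 1],
    expressed by one quadratic form, [energy]. This form serves three times. It makes the
    configuration determinants nonnegative, so that they can be taken as masses of cylinders and the
    measure can be constructed. It equals the squared norm of the out-of-window part of g, because
    multiplication by the indicator of A is an orthogonal projection. It makes 1 + s Q positive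
    definite for s > -1, as Hadamard's inequality requires.

    A bound on the ratio along infinitely many windows, which may depend on S and k, is enough: a
    window has only to contain the frequencies of one polynomial close to f. The exceptional null
    set is thus fixed before f is given.

    The obstacle in the upper bound for the density is that it concerns uncountably many sequences
    of intervals, out of reach of a union bound; the random sum over all intervals dominates the
    series of every such sequence at once. *)

Definition pick_rows (K : Type) (n : nat) (C : {set 'I_n}) (U V : 'M[K]_n) :=
  \matrix_(i, j) if i \in C then U i j else V i j.

(** Multilinearity in the rows: in the Leibniz formula, the product of the sums of entries is
    expanded over the set J of rows taken from U. *)
Lemma det_sum_rows (K : comNzRingType) (n : nat) (U V : 'M[K]_n) :
  \det (U + V) = \sum_(J : {set 'I_n}) \det (pick_rows J U V).
Proof.
rewrite /determinant exchange_big /=; apply: eq_bigr => s _.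
rewrite -big_distrr /=; congr (_ * _).
under eq_bigr do rewrite mxE.
rewrite bigA_distr; apply: eq_bigr => J _; apply: eq_bigr => i _.
by rewrite mxE.
Qed.

(* If Q is the minor of a determinantal kernel on a finite window, then
   det (config_mx Q C) is the probability that the trace of the random set on
   the window is exactly C. *)
Definition config_mx (K : nzRingType) (n : nat) (Q : 'M[K]_n) (C : {set 'I_n}) :=
  pick_rows C Q (1%:M - Q).

(** These are the inclusion probabilities: off C the rows on the right are unit vectors, so that the
    determinant is the principal minor of Q on C. In the row expansion, a set J that misses a point
    of C contributes a matrix with a zero row. *)
Lemma sum_config_superset (K : comNzRingType) (n : nat) (Q : 'M[K]_n)
    (C : {set 'I_n}) :
  \sum_(J : {set 'I_n} | C \subset J) \det (config_mx Q J)
  = \det (pick_rows C Q 1%:M).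
Proof.
have -> : pick_rows C Q 1%:M = Q + pick_rows C 0 (1%:M - Q).
  by apply/matrixP => i j; rewrite !mxE; case: ifP; rewrite ?addr0 ?subrKC.
rewrite det_sum_rows [RHS](bigID (fun J : {set 'I_n} => C \subset J)) /=.
rewrite [X in _ + X]big1 ?addr0; last first.
  move=> J nCJ; have [i iC iJ] := fintype.subsetPn nCJ; rewrite (expand_det_row _ i) big1// => j _.
  by rewrite !mxE (negbTE iJ) iC mul0r.
apply: eq_bigr => J CJ; congr (\det _); apply/matrixP => i j; rewrite !mxE.
by case: ifPn => // iJ; case: ifPn => // iC; rewrite (fintype.subsetP CJ _ iC) in iJ.
Qed.

(** Since 1 + (z - 1) Q = z Q + (1 - Q), the row expansion yields the configuration matrices with
    the rows of J scaled by z. *)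
Lemma sum_config_exp (K : comNzRingType) (n : nat) (Q : 'M[K]_n) (z : K) :
  \sum_(J : {set 'I_n}) \det (config_mx Q J) * z ^+ #|J|
  = \det (1%:M + (z - 1) *: Q).
Proof.
have -> : 1%:M + (z - 1) *: Q = z *: Q + (1%:M - Q).
  by apply/matrixP => i j; rewrite !mxE mulrBl mul1r addrCA.
rewrite det_sum_rows; apply: eq_bigr => J _; rewrite mulrC.
have -> : pick_rows J (z *: Q) (1%:M - Q) =
    diag_mx (\row_i (if i \in J then z else 1)) *m config_mx Q J.
  apply/matrixP => i j; rewrite mul_diag_mx !mxE.
  by case: ifP => // _; rewrite mul1r.
rewrite det_mulmx det_diag; congr (_ * _).
under eq_bigr do rewrite mxE.
by rewrite -big_mkcond /= prodr_const.
Qed.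

(** * The quadratic form of Q (1 - Q) and the sign of the configuration determinants *)

Section Energy.
Variable C : numClosedFieldType.

Definition hermitian_mx n (Q : 'M[C]_n) := forall i j, Q j i = (Q i j)^*.

(** For Hermitian Q this is the quadratic form of Q (1 - Q) at c; it is nonnegative for all c
    exactly when the eigenvalues of Q lie in [0, 1]. *)
Definition energy n (Q : 'M[C]_n) (c : 'cV[C]_n) : C :=
  \sum_i ((Q *m c) i 0)^* * ((1%:M - Q) *m c) i 0.

(* c is column k of the inverse of config_mx Q D: Q c vanishes on D off k, and
   (1 - Q) c vanishes off D, so that only the term k of the energy survives. *)
Lemma config_minimizer n (Q : 'M[C]_n) (D : {set 'I_n}) (k : 'I_n) :
  k \in D -> \det (config_mx Q D) != 0 ->
  exists c : 'cV[C]_n,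
    (forall i, i \in D -> (Q *m c) i 0 = (i == k)%:R) /\
    energy Q c * \det (config_mx Q D) = \det (config_mx Q (D :\ k)).
Proof.
move=> kD dD; set M := config_mx Q D; have uM : M \in unitmx by rewrite unitmxE unitfE.
pose c := col k (invmx M).
have Mc : M *m c = delta_mx k 0.
  by rewrite /c colE mulmxA mulmxV// mul1mx.
have Qc i : i \in D -> (Q *m c) i 0 = (i == k)%:R.
  move=> iD; have /matrixP/(_ i 0) := Mc; rewrite [RHS]mxE eqxx andbT => <-.
  by rewrite !mxE; apply: eq_bigr => j _; rewrite !mxE iD.
have Pc i : i \notin D -> ((1%:M - Q) *m c) i 0 = 0.
  move=> iD; have /matrixP/(_ i 0) := Mc; rewrite [RHS]mxE eqxx andbT.
  have /negbTE-> : i != k by apply: contraNneq iD => ->.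
  rewrite mulr0n => <-; rewrite !mxE; apply: eq_bigr => j _.
  by rewrite [M i j]mxE (negbTE iD).
exists c; split=> //.
have -> : energy Q c = ((1%:M - Q) *m c) k 0.
  rewrite /energy (bigD1 k)//= Qc// eqxx conjC1 mul1r big1 ?addr0// => i ik.
  have [iD|iD] := boolP (i \in D); last by rewrite Pc ?mulr0.
  by rewrite Qc// (negbTE ik) conjC0 mul0r.
(* Cramer's rule: row k of the matrix of D \ k is row k of 1 - Q, and the cofactors along it are
   those of M, that is, the entries of c times the determinant of M. *)
rewrite [RHS](expand_det_row _ k) mxE mulr_suml; apply: eq_bigr => j _.
rewrite -mulrA; congr (_ * _).
  by rewrite !mxE finset.setD11.
rewrite /c !mxE /invmx uM mulrC !mxE mulrCA.
rewrite -/M mulrA mulVr ?unitfE// mul1r /cofactor; congr (_ * \det _).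
apply/matrixP => a b; rewrite !mxE !inE.
by have -> : lift k a != k by rewrite eq_sym neq_lift.
Qed.

End Energy.

Section Positivity.
Variable C : numClosedFieldType.

(** Changing the sign of the rows off D turns the matrix into Q minus the diagonal projection off D,
    which is Hermitian. *)
Lemma det_config_real n (Q : 'M[C]_n) (D : {set 'I_n}) :
  hermitian_mx Q -> (\det (config_mx Q D))^* = \det (config_mx Q D).
Proof.
move=> hQ.
pose J : 'rV[C]_n := \row_i (if i \in D then 1 else -1).
pose N : 'M[C]_n := Q - diag_mx (\row_i (i \notin D)%:R).
have -> : config_mx Q D = diag_mx J *m N.
  apply/matrixP => i j; rewrite mul_diag_mx !mxE; case: ifPn => iD.
    by rewrite mul0rn subr0 mul1r.
  by rewrite mulN1r opprB.
rewrite -det_map_mx /=.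
have -> : map_mx Num.conj_op (diag_mx J *m N) = diag_mx J *m N^T.
  apply/matrixP => i j; rewrite mxE !mul_diag_mx !mxE rmorphM rmorphB /=.
  rewrite rmorphMn /= conjC_nat -hQ eq_sym; congr (_ * _).
    by case: ifP => _; rewrite ?rmorphN rmorph1.
  by case: (eqVneq j i) => [->|_]; rewrite ?mulr0n.
by rewrite !det_mulmx det_tr.
Qed.

Lemma hermitian_dot n (Q : 'M[C]_n) (c : 'cV[C]_n) : hermitian_mx Q ->
  \sum_i ((Q *m c) i 0)^* * c i 0 = \sum_i (c i 0)^* * (Q *m c) i 0.
Proof.
move=> hQ; under eq_bigr do rewrite mxE rmorph_sum mulr_suml /=.
rewrite exchange_big /=; apply: eq_bigr => i _.
rewrite mxE mulr_sumr; apply: eq_bigr => j _.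
by rewrite rmorphM /= -hQ mulrAC mulrC mulrA.
Qed.

(** Mixing Q with 1/2 pushes its spectrum into ]0, 1[, which makes the energy of a nonzero vector
    positive. But a kernel vector has energy 0: in every term one of the two factors vanishes, the
    first on D and the second off D. *)
Lemma config_mx_unit_interior n (Q : 'M[C]_n) (D : {set 'I_n}) (t : C) :
  hermitian_mx Q -> (forall c : 'cV[C]_n, 0 <= energy Q c) ->
  0 <= t -> t < 1 ->
  \det (config_mx (t *: Q + ((1 - t) / 2)%:M) D) != 0.
Proof.
move=> hQ EQ t0 t1; set s := (1 - t) / 2; set Qt := _ + _.
have s0 : 0 < s by rewrite divr_gt0 ?subr_gt0.
have ct : t^* = t by apply/CrealP/ger0_real.
have cs : s^* = s by apply/CrealP/gtr0_real.
apply/negP; rewrite -det_tr => /det0P [v vN0 /(congr1 trmx)].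
rewrite trmx_mul trmxK trmx0; set c := v^T => Mc.
have E0 : energy Qt c = 0.
  rewrite /energy big1// => i _; have /matrixP/(_ i 0) := Mc.
  rewrite [RHS]mxE => Mi; have [iD|iD] := boolP (i \in D).
    suff -> : (Qt *m c) i 0 = 0 by rewrite conjC0 mul0r.
    by rewrite -Mi !mxE; apply: eq_bigr => j _; rewrite [X in _ = X * _]mxE iD.
  suff -> : ((1%:M - Qt) *m c) i 0 = 0 by rewrite mulr0.
  rewrite -Mi !mxE; apply: eq_bigr => j _.
  by rewrite [X in _ = X * _]mxE (negbTE iD).
have QtE i : (Qt *m c) i 0 = t * (Q *m c) i 0 + s * c i 0.
  by rewrite mulmxDl -scalemxAl mul_scalar_mx !mxE.
have subE (B : 'M[C]_n) i : ((1%:M - B) *m c) i 0 = c i 0 - (B *m c) i 0.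
  by rewrite mulmxBl mul1mx !mxE.
(* As 1 - s = t + s, the two factors are t Q + s and t (1 - Q) + s, and the cross terms add up to t
   s times the squared norm of c. *)
have ExpE : energy Qt c = t ^+ 2 * energy Q c +
    (t * s + s ^+ 2) * \sum_i (c i 0)^* * c i 0.
  transitivity (t ^+ 2 * energy Q c +
    (t * s + s ^+ 2) * (\sum_i (c i 0)^* * c i 0) + t * s *
   (\sum_i ((Q *m c) i 0)^* * c i 0 - \sum_i (c i 0)^* * (Q *m c) i 0)); last first.
    by rewrite hermitian_dot// subrr mulr0 addr0.
  rewrite /energy -sumrB !mulr_sumr -!big_split /=; apply: eq_bigr => i _.
  rewrite !subE QtE.
  rewrite rmorphD (rmorphM _ t) (rmorphM _ s) /= ct cs /s; by field.
have : 0 < energy Qt c.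
  rewrite ExpE ltr_wpDl ?mulr_ge0 ?exprn_ge0// mulr_gt0//.
    by rewrite ltr_wpDl ?exprn_gt0// mulr_ge0// ltW.
  have [i ci] : exists i, c i 0 != 0.
    apply/existsP; apply: contraR vN0; rewrite negb_exists => /forallP c0.
    by apply/eqP/matrixP => a i; have := c0 i; rewrite negbK (ord1 a) !mxE => /eqP.
  rewrite (bigD1 i)//= ltr_pwDl//; first by rewrite mulrC mul_conjC_gt0.
  by rewrite sumr_ge0// => j _; rewrite mulrC mul_conjC_ge0.
by rewrite E0 ltxx.
Qed.

End Positivity.

Section ConfigurationDeterminant.
Variable R : rcfType.
Local Notation C := R[i]%type.

(* Along the segment from 1/2 to Q the determinant is real, positive at 1/2,
   and does not vanish before Q. *)
Lemma det_config_ge0 n (Q : 'M[C]_n) (D : {set 'I_n}) :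
  hermitian_mx Q -> (forall c : 'cV[C]_n, 0 <= energy Q c) ->
  0 <= \det (config_mx Q D).
Proof.
move=> hQ EQ.
pose Qt (t : C) := t *: Q + ((1 - t) / 2)%:M.
have hQt (t : R) : hermitian_mx (Qt t%:C%C).
  move=> i j; rewrite !mxE rmorphD rmorphM rmorphMn /= -hQ eq_sym.
  have cr (x : R) : (x%:C%C : C)^* = x%:C%C by rewrite -[LHS]/(conjc _) conjc_real.
  rewrite cr; congr (_ + _ *+ _).
  suff -> : (1 - t%:C%C) / 2 = ((1 - t) / 2)%:C%C :> C by rewrite cr.
  by rewrite rmorphM fmorphV rmorphB rmorph1 rmorph_nat.
(* The intermediate value theorem over a real closed field is one for polynomials, so the
   determinant along the segment is made a polynomial in t, and then one with real coefficients. *)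
have [PQ PQE] : exists PQ : 'M[{poly C}]_n,
    forall t i j, horner_eval t (PQ i j) = Qt t i j.
  exists ('X *: map_mx polyC Q + ((1 - 'X) * (2^-1)%:P)%:M) => t i j.
  by rewrite !mxE horner_evalE hornerD hornerM hornerX hornerC hornerMn !hornerE.
pose p := \det (config_mx PQ D).
have pE t : p.[t] = \det (config_mx (Qt t) D).
  rewrite -horner_evalE -det_map_mx; congr (\det _); apply/matrixP => i j.
  rewrite !mxE; case: ifP => _; first by rewrite /= PQE !mxE.
  by rewrite rmorphB /= PQE !mxE rmorph_nat.
pose rp : {poly R} := \poly_(i < size p) complex.Re p`_i.
have rpE (t : R) : rp.[t] = complex.Re p.[t%:C%C].
  rewrite horner_poly horner_coef raddf_sum; apply: eq_bigr => i _.
  rewrite -rmorphXn /= mulrC; case: (p`_i) => x y /=.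
  by rewrite mulr0 subr0 mulrC.
have preal (t : R) : p.[t%:C%C] = (rp.[t])%:C%C.
  by rewrite rpE; apply/esym/RRe_real/CrealP; rewrite pE det_config_real.
have -> : \det (config_mx Q D) = (rp.[1])%:C%C.
  rewrite -preal pE; congr (\det (config_mx _ D)).
  by rewrite /Qt subrr mul0r scale1r raddf0 addr0.
rewrite ler0c leNgt; apply/negP => rp1.
have rp0 : 0 < rp.[0].
  rewrite -ltcR -preal pE (rmorph0 (real_complex R)).
  have -> : config_mx (Qt 0) D = (2^-1 : C)%:M.
    apply/matrixP => i j; rewrite !mxE !mul0r !add0r subr0 mul1r.
    by case: ifP => // _; case: eqP => _; rewrite ?mulr1n ?mulr0n ?subr0//; field.
  by rewrite det_scalar exprn_gt0// invr_gt0 ltr0n.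
have [t /andP[t0 t1] rpt] : exists2 t, 0 <= t <= 1 & rp.[t] = 0.
  have [|t t01 /rootP] := @Num.Theory.poly_ivt R (- rp) 0 1 ler01.
    by rewrite !hornerN oppr_le0 oppr_ge0 !ltW.
  by rewrite hornerN => /eqP; rewrite oppr_eq0 => /eqP ?; exists t.
have {}t1 : t < 1 by rewrite lt_neqAle t1 andbT; apply: contraTneq rp1 => <-; rewrite rpt ltxx.
have := @config_mx_unit_interior C n Q D t%:C%C hQ EQ.
rewrite ler0c t0 ltcR => /(_ isT t1).
by rewrite -pE preal rpt eqxx.
Qed.

End ConfigurationDeterminant.

(** * Hadamard's determinant inequality *)

Section Hadamard.
Variable C : numClosedFieldType.

Definition posdef n (S : 'M[C]_n) :=
  forall x : 'cV[C]_n, x != 0 -> 0 < \sum_i (x i 0)^* * (S *m x) i 0.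

(** Induction by Schur complements: eliminating the positive corner entry a leaves a positive
    definite matrix N whose diagonal entries are those of S diminished by |S i 0|^2 / a. *)
Lemma hadamard_det n (S : 'M[C]_n) : hermitian_mx S -> posdef S ->
  0 <= \det S <= \prod_i S i i.
Proof.
elim: n S => [S _ _|n IH S]; first by rewrite det_mx00 big_ord0 ler01 lexx.
move=> hS pS; set a := S 0 0.
have a0 : 0 < a.
  have := pS (delta_mx 0 0) _; rewrite (bigD1 0)//= big1 ?addr0.
    rewrite mxE eqxx conjC1 mul1r -colE mxE; apply.
    by apply/eqP => /matrixP/(_ 0 0)/eqP; rewrite !mxE eqxx oner_eq0.
  by move=> i i0; rewrite mxE (negbTE i0) conjC0 mul0r.
have aN0 : a != 0 by rewrite gt_eqF.
have ca : a^* = a by rewrite -hS.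
pose N : 'M[C]_n := \matrix_(i, j)
  (S (lift 0 i) (lift 0 j) - S (lift 0 i) 0 * S 0 (lift 0 j) / a).
have hN : hermitian_mx N.
  move=> i j; rewrite !mxE rmorphB !rmorphM fmorphV /= ca -!hS.
  by congr (_ - _ / _); rewrite mulrC.
have pN : posdef N.
  (* This y0 is the first coordinate that minimises the form of S once the others are x: it makes
     coordinate 0 of S y vanish, and the form of S at y becomes that of N at x. *)
  move=> x x0; pose y0 := - (\sum_j S 0 (lift 0 j) * x j 0) / a.
  pose y : 'cV[C]_n.+1 := \col_i (if unlift 0 i is Some j then x j 0 else y0).
  have yl j : y (lift 0 j) 0 = x j 0 by rewrite mxE liftK.
  have y00 : y 0 0 = y0 by rewrite mxE unlift_none.
  have yN0 : y != 0.
    apply: contraNneq x0 => y_eq0; apply/eqP/matrixP => i j.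
    by rewrite (ord1 j) -yl y_eq0 !mxE.
  have := pS _ yN0; rewrite big_ord_recl.
  have -> : (S *m y) 0 0 = 0.
    rewrite mxE big_ord_recl y00 /y0 mulrC mulfVK// addrC; apply/eqP.
    by rewrite subr_eq0; apply/eqP/eq_bigr => j _; rewrite yl.
  rewrite mulr0 add0r; congr (_ < _); apply: eq_bigr => i _.
  rewrite yl; congr (_ * _); rewrite !mxE big_ord_recl y00 /y0.
  rewrite mulNr mulrN mulr_suml mulr_sumr -sumrN -big_split /=.
  apply: eq_bigr => j _; rewrite yl mxE mulrBl addrC; congr (_ - _).
  by rewrite -!mulrA; congr (_ * (_ * _)); rewrite mulrC.
(* N is the Schur complement of the corner entry a. *)
have detS : \det S = a * \det N.
  pose S' : 'M[C]_(1 + n) := S.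
  pose L : 'M[C]_(1 + n) := block_mx 1%:M 0 (a^-1 *: dlsubmx S') 1%:M.
  pose U : 'M[C]_(1 + n) := block_mx a%:M (ursubmx S') 0 N.
  have <- : \det (L *m U) = a * \det N.
    by rewrite det_mulmx det_lblock det_ublock !det1 det_scalar1 !mul1r.
  suff {1}-> : S = L *m U by [].
  rewrite -[LHS](@submxK _ 1 n 1 n) mulmx_block !mul1mx !mul0mx !addr0.
  rewrite -scalemxAl mul_mx_scalar scalerA mulVf// scale1r -/S'.
  have -> : a%:M = ulsubmx S' :> 'M[C]_1.
    apply/matrixP => i j; rewrite !mxE (ord1 i) (ord1 j) eqxx mulr1n.
    by congr (S _ _); apply/val_inj.
  congr (@block_mx _ 1 n 1 n _ _ _ _).
  apply/matrixP => i j; rewrite !mxE big_ord1 !mxE !rshift1 !lshift0.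
  by rewrite addrC mulrC mulrA subrK.
have /andP[d0 dle] := IH _ hN pN.
rewrite detS mulr_ge0 ?(ltW a0)//= big_ord_recl ler_pM2l//.
apply: (le_trans dle); apply: ler_prod => i _.
have Nii : 0 <= N i i.
  have := pN (delta_mx i 0) _; rewrite (bigD1 i)//= big1 ?addr0.
    rewrite mxE !eqxx conjC1 mul1r -colE [col _ _ _ _]mxE => H; apply/ltW/H.
    by apply/eqP => /matrixP/(_ i 0)/eqP; rewrite !mxE !eqxx oner_eq0.
  by move=> j ji; rewrite mxE (negbTE ji) conjC0 mul0r.
rewrite Nii /= mxE lerBlDr lerDl divr_ge0 ?(ltW a0)//.
by rewrite [S 0 _]hS mul_conjC_ge0.
Qed.

End Hadamard.

(** A principal minor lists a finite set in an order of its own, while windows are indexed by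
    injections. The unit rows off D are removed one at a time; when D is everything, the two orders
    differ by one permutation of both rows and columns, whose signs cancel. *)
Lemma det_pick_rows_seq (K : comNzRingType) (T : eqType) (x0 : T)
    (q : T -> T -> K) (n : nat) (e : 'I_n -> T) (D : {set 'I_n}) (s : seq T) :
  injective e -> uniq s -> s =i [seq e i | i in D] ->
  \det (pick_rows D (\matrix_(i, j) q (e i) (e j)) 1%:M)
  = \det (\matrix_(i < size s, j < size s) q (nth x0 s i) (nth x0 s j)).
Proof.
elim: n e D => [|n IH] e D injE us sE.
  case: s us sE => [_ _|x s _ sE]; first by rewrite !det_mx00.
  by have := sE x; rewrite mem_head => /esym/fintype.imageP[[]].
have [DT|] := eqVneq D finset.setT.
  have szs : size s = n.+1.
    have /perm_size-> : perm_eq s [seq e i | i in D].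
      by rewrite uniq_perm// map_inj_uniq// enum_uniq.
    by rewrite size_map -cardE DT cardsT card_ord.
  rewrite szs DT.
  have es i : e i \in s by rewrite sE DT map_f// mem_enum inE.
  have ltf i : (index (e i) s < n.+1)%N by rewrite -szs index_mem.
  pose f i := Ordinal (ltf i).
  have injf : injective f.
    move=> i j [] /(congr1 (nth x0 s)); rewrite !nth_index//; exact: injE.
  set B := (X in _ = \det X).
  have -> : pick_rows finset.setT (\matrix_(i, j) q (e i) (e j)) 1%:M =
            row_perm (perm injf) (col_perm (perm injf) B).
    by apply/matrixP => i j; rewrite !mxE finset.in_setT !permE /= !nth_index.
  rewrite row_permE col_permE !det_mulmx !det_perm odd_permV.
  by rewrite mulrCA -signr_addb addbb mulr1.
rewrite finset.eqEsubset finset.subsetT /= => DT; have [k _ kD] := fintype.subsetPn DT.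
rewrite (expand_det_row _ k) (bigD1 k)//= big1 ?addr0; last first.
  by move=> j jk; rewrite !mxE (negbTE kD) eq_sym (negbTE jk) mul0r.
rewrite !mxE (negbTE kD) eqxx mul1r /cofactor addnn -mul2n exprM sqrrN !expr1n mul1r.
rewrite -(IH (e \o lift k) [set i | lift k i \in D]%SET)//; last 2 first.
- exact/inj_comp/lift_inj.
- move=> x; rewrite sE; apply/fintype.imageP/fintype.imageP => -[i iD ->].
    have ki : k != i by apply: contraNneq kD => ->.
    have [j ij] := unlift_some ki.
    by exists j; rewrite ?inE /= -?ij.
  by exists (lift k i) => //; rewrite inE in iD.
congr (\det _); apply/matrixP => i j; rewrite !mxE inE.
by rewrite (inj_eq lift_inj).
Qed.

(** * Random subsets of Z with given cylinder probabilities *)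

(** The order 0, -1, 1, -2, 2, ...; its initial segments are the windows that exhaust Z. *)
Definition int_enum (n : nat) : int := if odd n then Negz n./2 else Posz n./2.

Definition int_rank (k : int) : nat :=
  match k with Posz m => m.*2 | Negz m => m.*2.+1 end.

Lemma int_rankK : cancel int_rank int_enum.
Proof. by case=> m; rewrite /int_enum /= odd_double /= ?uphalf_double ?doubleK. Qed.

Lemma int_enumK : cancel int_enum int_rank.
Proof.
move=> n; rewrite /int_enum -[RHS]odd_double_half.
by case: ifP => nodd /=; rewrite ?add1n ?add0n.
Qed.

Definition trace n (e : 'I_n -> int) (S : powZ) : {set 'I_n} := [set i | S (e i)].

Lemma open_coord (k : int) (b : bool) : open [set S : powZ | S k = b].
Proof.
have -> : [set S : powZ | S k = b] = (@proj int (fun=> bool) k) @^-1` [set b] by [].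
apply: open_comp; last exact: discrete_open.
by move=> S _; exact: proj_continuous.
Qed.

Lemma measurable_trace_eq n (e : 'I_n -> int) (C : {set 'I_n}) :
  measurable [set S : borel_powZ | trace e S = C].
Proof.
have -> : [set S : borel_powZ | trace e S = C] =
    \bigcap_(i in [set: 'I_n])
      [set S : borel_powZ | (S : powZ) (e i) = (i \in C)].
  apply/seteqP; split=> S /=.
    by move=> <- i _; rewrite /= inE.
  by move=> H; apply/setP => i; rewrite inE; exact: H.
apply: fin_bigcap_measurable => // i _.
by apply: sub_sigma_algebra; exact: open_coord.
Qed.

Lemma trace_bigcup n (e : 'I_n -> int) (G : pred {set 'I_n}) :
  [set S : borel_powZ | G (trace e S)] =
  \bigcup_(C in [set C | G C]) [set S : borel_powZ | trace e S = C].
Proof.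
by apply/seteqP; split=> S /=; [move=> GS; exists (trace e S)|case=> C /= GC ->].
Qed.

Lemma measurable_trace n (e : 'I_n -> int) (G : pred {set 'I_n}) :
  measurable [set S : borel_powZ | G (trace e S)].
Proof.
rewrite trace_bigcup; apply: fin_bigcup_measurable => [|C _].
  exact: finite_finset.
exact: measurable_trace_eq.
Qed.

Lemma prob_trace (R : realType) (P : probability borel_powZ R) n
    (e : 'I_n -> int) (G : pred {set 'I_n}) :
  fine (P [set S | G (trace e S)]) =
  \sum_(C : {set 'I_n} | G C) fine (P [set S | trace e S = C]).
Proof.
rewrite trace_bigcup measure_fin_bigcup//; last 3 first.
- exact: finite_finset.
- by move=> C D _ _ [S [/= <- <-]].
- by move=> C _; exact: measurable_trace_eq.
rewrite (@fsbigE _ _ _ _ _ (enum G)) ?enum_uniq//; last 2 first.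
- by move=> C /=; rewrite mem_enum.
- by move=> C /= GC; rewrite mem_enum => /negP.
rewrite sum_fine; last first.
  by move=> C _; rewrite fin_num_measure//; exact: measurable_trace_eq.
congr fine; rewrite big_mkcond big_enum /=; apply: eq_bigr => C GC.
by rewrite ifT// inE.
Qed.

(** Möbius inversion on the lattice of subsets, by induction on the size of the complement of C: all
    the terms but D = C are already known to agree. *)
Lemma superset_sum_inj (V : zmodType) n (f g : {set 'I_n} -> V) :
  (forall C : {set 'I_n}, \sum_(D : {set 'I_n} | C \subset D) f D =
             \sum_(D : {set 'I_n} | C \subset D) g D) ->
  f =1 g.
Proof.
move=> fg C; have [m] := ubnP #|~: C|; elim: m C => // m IH C Cm.
have := fg C; rewrite (bigD1 C)//= [in RHS](bigD1 C)//=.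
suff -> : \sum_(D : {set 'I_n} | (C \subset D) && (D != C)) f D =
          \sum_(D : {set 'I_n} | (C \subset D) && (D != C)) g D by move/addIr.
apply: eq_bigr => D /andP[CD DC]; apply: IH.
have : C \proper D by rewrite finset.properEneq eq_sym DC.
by rewrite -finset.properC => /proper_card; move: Cm; lia.
Qed.

Section Determinantal.
Variables (R : realType) (Q : int -> int -> R[i]).

Definition sub_mx n (e : 'I_n -> int) : 'M[R[i]]_n := \matrix_(i, j) Q (e i) (e j).

Lemma principal_minor_pick n (e : 'I_n -> int) (C : {set 'I_n}) (F : {fset int}) :
  injective e -> F =i [seq e i | i in C] ->
  principal_minor Q F = \det (pick_rows C (sub_mx e) 1%:M).
Proof.
move=> injE FE; rewrite /principal_minor /sub_mx.
by rewrite (det_pick_rows_seq 0 Q injE (fset_uniq F) FE).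
Qed.

(** [determinantal] prescribes inclusion probabilities only. Both sides here have these as their
    sums over supersets, and such sums determine the summands. *)
Lemma determinantal_trace (P : probability borel_powZ R) n
    (e : 'I_n -> int) (C : {set 'I_n}) :
  determinantal Q P -> injective e ->
  (fine (P [set S | trace e S = C]))%:C%C = \det (config_mx (sub_mx e) C).
Proof.
move=> dP injE; move: C; apply: superset_sum_inj => C.
rewrite sum_config_superset -rmorph_sum /= -(prob_trace P e (fun D => C \subset D)).
pose F := [fset e i | i in C]%fset.
have FE : F =i [seq e i | i in C].
  move=> x; apply/imfsetP/fintype.imageP => -[i iC ->]; by exists i.
rewrite -(principal_minor_pick injE FE) -dP; congr ((fine (P _))%:C)%C.
apply/seteqP; split=> S /= H.
  move=> k; rewrite FE => /fintype.imageP[i iC ->].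
  by have := fintype.subsetP H _ iC; rewrite inE.
apply/fintype.subsetP => i iC; rewrite inE; apply: H.
by rewrite FE; apply: fintype.image_f.
Qed.

End Determinantal.

Definition cylinder (s : seq bool) : set powZ :=
  [set S | forall i, (i < size s)%N -> S (int_enum i) = nth false s i].

(** The cylinders around S generate a filter that converges to S in every coordinate, because the
    value at k is frozen from length [int_rank k] + 1 on. The cylinders thus form a countable
    basis. *)
Lemma open_cylinder_basis (U : set powZ) (S : powZ) : open U -> U S ->
  exists n, cylinder (mkseq (fun i => S (int_enum i)) n) `<=` U.
Proof.
move=> oU US.
pose B n := cylinder (mkseq (fun i => S (int_enum i)) n).
have BE n T : B n T <-> forall i, (i < n)%N -> T (int_enum i) = S (int_enum i).
  rewrite /B /cylinder /= size_mkseq.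
  by split=> H i ni; have := H i ni; rewrite nth_mkseq.
pose F : set_system powZ := filter_from setT B.
have FF : Filter F.
  apply: filter_from_filter; first by exists 0%N.
  move=> i j _ _; exists (maxn i j) => // T /BE BT; split; apply/BE => l ll.
    by apply: BT; rewrite leq_max ll.
  by apply: BT; rewrite leq_max ll orbT.
have FS : F --> (S : prod_topology (fun _ : int => bool)).
  apply/cvg_sup => k A; rewrite (@nbhsE (initial_topology (fun f : int -> bool => f k))) => -[_ [[V oV <-] /= VS]] VA.
  exists (int_rank k).+1 => // T /BE/(_ (int_rank k) (ltnSn _)).
  by rewrite int_rankK => TS; apply: VA; rewrite /= TS.
have [n _ Bn] := FS _ (open_nbhs_nbhs (conj oU US)).
by exists n.
Qed.

(** * Kolmogorov extension for sequences of bits *)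

Section Existence.
Variables (R : realType) (p : seq bool -> R).
Hypotheses (p_ge0 : forall s, 0 <= p s) (p_nil : p [::] = 1).
Hypothesis p_rcons : forall s, p s = p (rcons s false) + p (rcons s true).

(* The cylinders are laid out in [0, 1[ as nested intervals [lo s, lo s + p s[;
   reading off the intervals that contain a uniform point gives the process *)
Definition lo (s : seq bool) : R :=
  \sum_(i < size s | nth false s i) p (rcons (take i s) false).

Lemma lo_rcons s b : lo (rcons s b) = lo s + (if b then p (rcons s false) else 0).
Proof.
rewrite /lo size_rcons big_mkcond big_ord_recr /= nth_rcons ltnn eqxx.
rewrite -cats1 take_size_cat// cats1; congr (_ + _).
rewrite [RHS]big_mkcond; apply: eq_bigr => i _.
by rewrite nth_rcons ltn_ord -(cats1 s b) takel_cat// ltnW.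
Qed.

Fixpoint digits (u : R) (n : nat) : seq bool :=
  if n is m.+1 then
    let s := digits u m in rcons s (lo s + p (rcons s false) <= u)
  else [::].

Lemma size_digits u n : size (digits u n) = n.
Proof. by elim: n => //= n IH; rewrite size_rcons IH. Qed.

Lemma take_digits u m n : (m <= n)%N -> take m (digits u n) = digits u m.
Proof.
elim: n => [|n IH]; first by rewrite leqn0 => /eqP->.
rewrite leq_eqVlt => /predU1P[->|mn]; first by rewrite take_oversize ?size_digits.
by rewrite /= -cats1 takel_cat ?IH// size_digits.
Qed.

Lemma digits_itv u n : 0 <= u < 1 ->
  lo (digits u n) <= u < lo (digits u n) + p (digits u n).
Proof.
move=> u01; elim: n => [|n /andP[lu ul]] /=; first by rewrite /lo big_ord0 p_nil add0r.
rewrite lo_rcons; case: ifPn => [->|] /=; last by rewrite addr0 -ltNge lu => ->.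
by rewrite -addrA -p_rcons.
Qed.

Lemma itv_digits u s : lo s <= u < lo s + p s -> digits u (size s) = s.
Proof.
elim/last_ind: s => [//|s b IH]; rewrite lo_rcons size_rcons /= => H.
have -> : digits u (size s) = s.
  apply: IH; rewrite (p_rcons s); move: H (p_ge0 (rcons s false)) (p_ge0 (rcons s true)).
  by case: b => /= /andP[? ?] ? ?; apply/andP; split; lra.
congr rcons; case: b H => /andP[H1 H2]; first by rewrite H1.
by apply/negbTE; rewrite -ltNge; rewrite addr0 in H2.
Qed.

Lemma lo_ge0 s : 0 <= lo s.
Proof. by apply: sumr_ge0. Qed.

Lemma lo_le1 s : lo s + p s <= 1.
Proof.
elim/last_ind: s => [|s b]; first by rewrite /lo big_ord0 add0r p_nil.
rewrite lo_rcons (p_rcons s); have := p_ge0 (rcons s false).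
by have := p_ge0 (rcons s true); case: b => /=; lra.
Qed.

Lemma measurable_digits s :
  measurable [set u : measurableTypeR R | digits u (size s) = s].
Proof.
elim/last_ind: s => [|s b IH].
  by rewrite (_ : mkset _ = setT)//; apply/seteqP; split.
have -> : [set u : measurableTypeR R | digits u (size (rcons s b)) = rcons s b] =
   [set u | digits u (size s) = s] `&`
   [set u | (lo s + p (rcons s false) <= u) = b].
  apply/seteqP; split=> u /=; rewrite size_rcons /=.
    by move=> /rcons_inj[-> ->].
  by move=> [-> ->].
apply: measurableI => //; case: {IH} b.
  rewrite (_ : mkset _ = `[lo s + p (rcons s false), +oo[%classic)//.
  by apply/seteqP; split => u /=; rewrite in_itv/= andbT.
rewrite (_ : mkset _ = `]-oo, lo s + p (rcons s false)[%classic)//.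
by apply/seteqP; split => u /=; rewrite in_itv/= ltNge; [move=> ->|move/negbTE].
Qed.

Definition process (u : measurableTypeR R) : borel_powZ :=
  fun k => nth false (digits u (int_rank k).+1) (int_rank k).

Lemma process_cylinder u s : cylinder s (process u) <-> digits u (size s) = s.
Proof.
have E i n : (i < n)%N -> process u (int_enum i) = nth false (digits u n) i.
  by move=> ni; rewrite /process int_enumK -(take_digits u ni) nth_take.
split=> [H|us i si]; last by rewrite (E _ (size s))// us.
apply: (@eq_from_nth _ false); first by rewrite size_digits.
by move=> i; rewrite size_digits => si; rewrite -E// H.
Qed.

(** An open set is the union of the cylinders that it contains, and there are countably many
    cylinders; its preimage is a countable union of events about finitely many digits. *)
Lemma measurable_process : measurable_fun setT process.
Proof.
apply: (@measurability _ _ (measurableTypeR R) borel_powZ setT process (@open powZ)) => // _ [U oU <-].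
rewrite setTI.
have -> : process @^-1` U = \bigcup_(n in [set: nat]) \bigcup_(s in
   [set s : n.-tuple bool | cylinder s `<=` U])
     [set u | digits u (size s) = s].
  apply/seteqP; split=> [u /= /(open_cylinder_basis oU)[n nU]|u].
    exists n => //; exists [tuple of mkseq (fun i => process u (int_enum i)) n] => //=.
    apply/process_cylinder => i; rewrite size_mkseq => ni.
    by rewrite nth_mkseq.
  by move=> [n _ [s /= sU us]]; apply: sU; exact/process_cylinder.
apply: bigcup_measurable => n _; apply: fin_bigcup_measurable.
  exact: finite_finset.
by move=> s _; exact: measurable_digits.
Qed.

HB.instance Definition _ :=
  @isMeasurableFun.Build _ _ _ _ process measurable_process.

Let I01 : set (measurableTypeR R) := `[0%R, 1%R[%classic.
Let mI01 : measurable I01. Proof. exact: measurable_itv. Qed.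

Definition unit_measure := mrestr (@lebesgue_measure R) mI01.
HB.instance Definition _ := Measure.on unit_measure.

Let unit_measureT : unit_measure setT = 1%E.
Proof. by rewrite /unit_measure /mrestr setTI lebesgue_measure_itv/= lte01 oppr0 adde0. Qed.

HB.instance Definition _ :=
  Measure_isProbability.Build _ _ _ unit_measure unit_measureT.

(** The measure is the law of [process] under Lebesgue measure on [0, 1[: the points whose digits
    start with s fill an interval of length p s. *)
Lemma probability_of_cylinders :
  exists P : probability borel_powZ R, forall s, P (cylinder s) = (p s)%:E.
Proof.
exists (distribution unit_measure process) => s.
rewrite /distribution /= /pushforward /unit_measure /mrestr.
have -> : process @^-1` cylinder s `&` I01 = `[lo s, lo s + p s[%classic.
  apply/seteqP; split=> u /=.
    move=> [/process_cylinder us]; rewrite /I01 /= !in_itv /= => u01.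
    by have := digits_itv (size s) u01; rewrite us.
  rewrite in_itv /= => H; split; first by apply/process_cylinder; exact: itv_digits.
  rewrite /I01 /= in_itv /=; move: H (lo_ge0 s) (lo_le1 s) => /andP[? ?] ? ?.
  by apply/andP; split; lra.
rewrite lebesgue_measure_itv /= lte_fin ltrDl; case: ltP => [_|p0].
  by rewrite -EFinB addrC addKr.
by congr EFin; apply/eqP; rewrite eq_le p0 p_ge0.
Qed.

End Existence.

(** Consistency when the coordinate k is summed out: the two matrices differ in row k only, where
    their rows add up to a unit vector, and expansion along it leaves the minor without k. *)
Lemma det_config_split (K : comNzRingType) n (Q : 'M[K]_n.+1) (C : {set 'I_n.+1})
    (k : 'I_n.+1) :
  \det (config_mx Q (k |: C)) + \det (config_mx Q (C :\ k)) =
  \det (config_mx (row' k (col' k Q)) (lift k @^-1: C)).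
Proof.
rewrite (expand_det_row _ k) [X in _ + X](expand_det_row _ k) -big_split /=.
have cofE D j : D :\ k = C :\ k ->
    cofactor (config_mx Q D) k j = cofactor (config_mx Q C) k j.
  move=> /setP DC; rewrite /cofactor; congr (_ * \det _); apply/matrixP => a b.
  have := DC (lift k a).
  by rewrite !mxE !inE [_ == k]eq_sym neq_lift /= => ->.
under eq_bigr => j _.
  rewrite (cofE (k |: C)) ?(cofE (C :\ k)); last 2 first.
  - by apply/setP => i; rewrite !inE; case: (i == k).
  - by apply/setP => i; rewrite !inE; case: (i == k).
  rewrite !mxE !inE eqxx /= -mulrDl subrKC.
  over.
rewrite (bigD1 k)//= big1 ?addr0; last first.
  by move=> j jk; rewrite eq_sym (negbTE jk) mul0r.
rewrite eqxx mul1r /cofactor addnn -mul2n exprM sqrrN !expr1n mul1r.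
congr (\det _); apply/matrixP => a b; rewrite !mxE !inE.
by rewrite (inj_eq lift_inj).
Qed.

Section DeterminantalExistence.
Variables (R : realType) (Q : int -> int -> R[i]).
Hypothesis herm : forall j k, Q k j = Num.conj (Q j k).
Hypothesis contr : forall n (e : 'I_n -> int) (c : 'cV_n), injective e ->
  0 <= energy (sub_mx Q e) c.

Definition seg n (i : 'I_n) : int := int_enum i.

Lemma seg_inj n : injective (@seg n).
Proof. by move=> i j /(can_inj int_enumK) /val_inj. Qed.

Lemma sub_mx_herm n (e : 'I_n -> int) : hermitian_mx (sub_mx Q e).
Proof. by move=> i j; rewrite !mxE herm. Qed.

Lemma config_ge0 n (e : 'I_n -> int) (C : {set 'I_n}) : injective e ->
  0 <= \det (config_mx (sub_mx Q e) C).
Proof.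
move=> injE; apply: det_config_ge0; first exact: sub_mx_herm.
by move=> c; exact: contr.
Qed.

Definition config_prob n (f : nat -> bool) : R :=
  complex.Re (\det (config_mx (sub_mx Q (@seg n)) [set i : 'I_n | f i])).

Lemma config_probE n f :
  (config_prob n f)%:C%C = \det (config_mx (sub_mx Q (@seg n)) [set i : 'I_n | f i]).
Proof. by apply/RRe_real/ger0_real/config_ge0; exact: seg_inj. Qed.

(** The configuration determinants are nonnegative and consistent, hence the cylinder masses of a
    probability. The inclusion probability of F is recovered by summing over the configurations of a
    window that contains F. *)
Lemma determinantal_exists :
  exists P : probability borel_powZ R, determinantal Q P.
Proof.
pose p s := config_prob (size s) (nth false s).
have p_ge0 s : 0 <= p s by rewrite -ler0c config_probE config_ge0//; exact: seg_inj.
have p_nil : p [::] = 1.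
  by apply: complexI; rewrite config_probE det_mx00.
have p_rcons s : p s = p (rcons s false) + p (rcons s true).
  apply: complexI; rewrite rmorphD /= !config_probE.
  rewrite !size_rcons addrC.
  set n := size s; pose C := [set i : 'I_n.+1 | nth false (rcons s true) i]%SET.
  have -> : [set i : 'I_n.+1 | nth false (rcons s true) i]%SET = ord_max |: C.
    by apply/setP => i; rewrite !inE; case: eqVneq => //= ->; rewrite nth_rcons ltnn eqxx.
  have -> : [set i : 'I_n.+1 | nth false (rcons s false) i]%SET = C :\ ord_max.
    apply/setP => i; rewrite !inE !nth_rcons -/n.
    have [->|iN] := eqVneq i ord_max; first by rewrite ltnn eqxx.
    have ni : (i < n)%N.
      move: (ltn_ord i) iN; rewrite -val_eqE /= ltnS leq_eqVlt.
      by move=> /orP[/eqP->|//]; rewrite eqxx.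
    by rewrite ni.
  rewrite det_config_split; congr (\det (config_mx _ _)).
    by apply/matrixP => i j; rewrite !mxE /seg !lift_max.
  by apply/setP => i; rewrite !inE nth_rcons lift_max ltn_ord.
have [P PE] := probability_of_cylinders p_ge0 p_nil p_rcons.
exists P => F.
pose N := (\max_(k <- F) int_rank k).+1.
have FN k : k \in F -> (int_rank k < N)%N.
  by move=> kF; rewrite ltnS; exact: leq_bigmax_seq.
pose C := [set i : 'I_N | seg i \in F]%SET.
have FE : F =i [seq seg i | i in C].
  move=> k; apply/idP/fintype.imageP => [kF|[i iC ->]]; last by rewrite inE in iC.
  exists (Ordinal (FN _ kF)); last by rewrite /seg /= int_rankK.
  by rewrite inE /seg /= int_rankK.
rewrite (principal_minor_pick Q (@seg_inj N) FE) -sum_config_superset.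
have -> : [set S : powZ | forall k, k \in F -> S k] =
          [set S : borel_powZ | C \subset trace (@seg N) S].
  apply/seteqP; split=> S /= H.
    by apply/fintype.subsetP => i; rewrite !inE; exact: H.
  move=> k; rewrite FE => /fintype.imageP[i iC ->].
  by have := fintype.subsetP H _ iC; rewrite inE.
rewrite (prob_trace P (@seg N) (fun D => C \subset D)) rmorph_sum /=.
apply: eq_bigr => D _.
pose s := [tuple i \in D | i < N].
have sN : size s = N by exact: size_tuple.
have -> : [set S : borel_powZ | trace (@seg N) S = D] = cylinder s.
  apply/seteqP; split=> S.
    move=> /= SD i; rewrite sN => iN.
    by rewrite -(tnth_nth false s (Ordinal iN)) tnth_mktuple -SD inE.
  move=> H; apply/setP => i; rewrite inE /seg H ?sN//.
  by rewrite -(tnth_nth false s) tnth_mktuple.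
transitivity ((p s)%:C%C); first by congr (_%:C)%C; exact: (congr1 fine (PE s)).
rewrite config_probE.
have : forall n, n = N -> \det (config_mx (sub_mx Q (@seg n)) [set i : 'I_n | nth false s i]) = \det (config_mx (sub_mx Q (@seg N)) D).
  move=> n ->; congr (\det (config_mx _ _)); apply/setP => i.
  by rewrite inE -(tnth_nth false s) tnth_mktuple.
by apply.
Qed.

End DeterminantalExistence.

(** * Complex inner product on square-integrable functions *)

Section ComplexParts.
Variable R : realType.
Implicit Types z w : R[i].

Lemma cReD z w : complex.Re (z + w) = complex.Re z + complex.Re w.
Proof. by case: z => ? ?; case: w. Qed.
Lemma cImD z w : complex.Im (z + w) = complex.Im z + complex.Im w.
Proof. by case: z => ? ?; case: w. Qed.
Lemma cReN z : complex.Re (- z) = - complex.Re z.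
Proof. by case: z. Qed.
Lemma cImN z : complex.Im (- z) = - complex.Im z.
Proof. by case: z. Qed.
Lemma cReM z w : complex.Re (z * w) =
  complex.Re z * complex.Re w - complex.Im z * complex.Im w.
Proof. by case: z => ? ?; case: w. Qed.
Lemma cImM z w : complex.Im (z * w) =
  complex.Re z * complex.Im w + complex.Im z * complex.Re w.
Proof. by case: z => ? ?; case: w. Qed.
Lemma cReJ z : complex.Re z^* = complex.Re z.
Proof. by case: z. Qed.
Lemma cImJ z : complex.Im z^* = - complex.Im z.
Proof. by case: z. Qed.
Lemma complex_ext z w :
  complex.Re z = complex.Re w -> complex.Im z = complex.Im w -> z = w.
Proof. by case: z => ? ?; case: w => ? ? /= -> ->. Qed.

Definition nsq z : R := complex.Re z ^+ 2 + complex.Im z ^+ 2.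

Lemma nsq_ge0 z : 0 <= nsq z.
Proof. by rewrite addr_ge0// sqr_ge0. Qed.
Lemma nsqE z : (nsq z)%:C%C = z * z^*.
Proof.
by apply: complex_ext; rewrite ?cReM ?cImM cReJ cImJ /nsq/=; ring.
Qed.
Lemma normc_sqr z : Normc.normc z ^+ 2 = nsq z.
Proof. by case: z => a b; rewrite /nsq /= sqr_sqrtr// addr_ge0// sqr_ge0. Qed.
Lemma nsqM z w : nsq (z * w) = nsq z * nsq w.
Proof. by rewrite /nsq cReM cImM; ring. Qed.
Lemma nsqJ z : nsq z^* = nsq z.
Proof. by rewrite /nsq cReJ cImJ; ring. Qed.
Lemma nsqD_le z w : nsq (z + w) <= 2 * nsq z + 2 * nsq w.
Proof.
rewrite /nsq cReD cImD -subr_ge0.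
have := sqr_ge0 (complex.Re z - complex.Re w).
by have := sqr_ge0 (complex.Im z - complex.Im w); lra.
Qed.
Lemma normr_Re_mul z w : `|complex.Re (z * w)| <= nsq z + nsq w.
Proof.
rewrite cReM /nsq; move: (complex.Re z) (complex.Im z) (complex.Re w) (complex.Im w) => a b c d.
have := sqr_ge0 (a - c); have := sqr_ge0 (a + c).
have := sqr_ge0 (b - d); have := sqr_ge0 (b + d); have := sqr_ge0 a; have := sqr_ge0 b.
have := sqr_ge0 c; have := sqr_ge0 d.
by rewrite ler_norml; move=> *; apply/andP; split; lra.
Qed.
Lemma normr_Im_mul z w : `|complex.Im (z * w)| <= nsq z + nsq w.
Proof.
rewrite cImM /nsq; move: (complex.Re z) (complex.Im z) (complex.Re w) (complex.Im w) => a b c d.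
have := sqr_ge0 (a - d); have := sqr_ge0 (a + d).
have := sqr_ge0 (b - c); have := sqr_ge0 (b + c); have := sqr_ge0 a; have := sqr_ge0 b.
have := sqr_ge0 c; have := sqr_ge0 d.
by rewrite ler_norml; move=> *; apply/andP; split; lra.
Qed.
Lemma nsq_eq0 z : (nsq z == 0) = (z == 0).
Proof. by case: z => a b; rewrite /nsq eq_complex/= paddr_eq0 ?sqr_ge0// !sqrf_eq0. Qed.

End ComplexParts.

Section L2.
Context d (T : measurableType d) (R : realType) (mu : {measure set T -> \bar R}).
Variables (D : set T) (mD : measurable D).
Implicit Types f g h : T -> R[i].

Definition cmeas f := measurable_fun D (fun x => complex.Re (f x)) /\
  measurable_fun D (fun x => complex.Im (f x)).

Definition cintegral f : R[i] :=
  ((\int[mu]_(x in D) complex.Re (f x))%R +i* (\int[mu]_(x in D) complex.Im (f x))%R)%C.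

Definition L2 f := cmeas f /\ mu.-integrable D (EFin \o (fun x => nsq (f x))).

Definition ip f g := cintegral (fun x => f x * (g x)^*).

Lemma cmeasD f g : cmeas f -> cmeas g -> cmeas (fun x => f x + g x).
Proof.
move=> [f1 f2] [g1 g2]; split.
  by under eq_fun do rewrite cReD; exact: measurable_funD.
by under eq_fun do rewrite cImD; exact: measurable_funD.
Qed.

Lemma cmeasM f g : cmeas f -> cmeas g -> cmeas (fun x => f x * g x).
Proof.
move=> [f1 f2] [g1 g2]; split.
  by under eq_fun do rewrite cReM; apply: measurable_funB; exact: measurable_funM.
by under eq_fun do rewrite cImM; apply: measurable_funD; exact: measurable_funM.
Qed.

Lemma cmeasJ f : cmeas f -> cmeas (fun x => (f x)^*).
Proof.
move=> [f1 f2]; split; first by under eq_fun do rewrite cReJ.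
by under eq_fun do rewrite cImJ; exact: measurable_funN.
Qed.

Lemma cmeas_cst c : cmeas (fun=> c).
Proof. by split; exact: measurable_cst. Qed.

Lemma cmeas_nsq f : cmeas f -> measurable_fun D (fun x => nsq (f x)).
Proof.
by move=> [? ?]; apply: measurable_funD; exact: measurable_funX.
Qed.

Lemma L2_dominated f (u : T -> R) : cmeas f -> mu.-integrable D (EFin \o u) ->
  (forall x, D x -> nsq (f x) <= u x) -> L2 f.
Proof.
move=> mf iu fu; split=> //; apply: le_integrable iu => //.
  exact/measurable_EFinP/cmeas_nsq.
move=> x Dx /=; rewrite lee_fin ger0_norm ?nsq_ge0//.
by rewrite (le_trans (fu _ Dx))// ler_norm.
Qed.

Lemma L2D f g : L2 f -> L2 g -> L2 (fun x => f x + g x).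
Proof.
move=> [mf f2] [mg g2].
apply: (@L2_dominated _ (fun x => 2 * nsq (f x) + 2 * nsq (g x))).
- exact: cmeasD.
- have -> : EFin \o (fun x => 2 * nsq (f x) + 2 * nsq (g x)) =
    ((fun x => 2%R%:E * (nsq (f x))%:E) \+ (fun x => 2%R%:E * (nsq (g x))%:E))%E by [].
  by apply: integrableD => //; exact: integrableZl.
- by move=> x _; exact: nsqD_le.
Qed.

Lemma L2_mul_bounded (K : R) g f : cmeas g -> (forall x, D x -> nsq (g x) <= K) ->
  L2 f -> L2 (fun x => g x * f x).
Proof.
move=> mg gK [mf f2].
apply: (@L2_dominated _ (fun x => K * nsq (f x))).
- exact: cmeasM.
- have -> : EFin \o (fun x => K * nsq (f x)) = (fun x => K%:E * (nsq (f x))%:E)%E by [].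
  exact: integrableZl.
- by move=> x Dx; rewrite nsqM ler_wpM2r ?nsq_ge0// gK.
Qed.

Lemma L2Z c f : L2 f -> L2 (fun x => c * f x).
Proof. by apply: (@L2_mul_bounded (nsq c)) => //; exact: cmeas_cst. Qed.

Lemma L2N f : L2 f -> L2 (fun x => - f x).
Proof. by move=> /(L2Z (-1)); under eq_fun do rewrite mulN1r. Qed.

Lemma L2B f g : L2 f -> L2 g -> L2 (fun x => f x - g x).
Proof. by move=> Lf /L2N; exact: L2D. Qed.

Lemma L20 : L2 (fun=> 0).
Proof.
split; first exact: cmeas_cst.
have -> : EFin \o (fun=> nsq (0 : R[i])) = cst 0%E :> (T -> \bar R).
  by apply/funext => x; congr EFin; apply/eqP; rewrite nsq_eq0.
exact: integrable0.
Qed.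

Lemma L2_sum (I : Type) (r : seq I) (P : pred I) (F : I -> T -> R[i]) :
  (forall i, P i -> L2 (F i)) -> L2 (fun x => \sum_(i <- r | P i) F i x).
Proof.
move=> LF; elim: r => [|i r IH].
  by under eq_fun do rewrite big_nil; exact: L20.
have [Pi|Pi] := boolP (P i).
  by under eq_fun do rewrite big_cons Pi; apply: L2D => //; exact: LF.
by under eq_fun do rewrite big_cons (negbTE Pi).
Qed.

Lemma L2_Re_integrable f g : L2 f -> L2 g ->
  mu.-integrable D (EFin \o (fun x => complex.Re (f x * (g x)^*))).
Proof.
move=> [mf f2] [mg g2].
apply: (le_integrable mD _ _ (integrableD mD f2 g2)).
  by apply/measurable_EFinP; apply: (cmeasM mf (cmeasJ mg)).1.
move=> x Dx; rewrite /= lee_fin [leRHS]ger0_norm ?(addr_ge0 (nsq_ge0 _) (nsq_ge0 _))//.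
by rewrite -(nsqJ (g x)) normr_Re_mul.
Qed.

Lemma L2_Im_integrable f g : L2 f -> L2 g ->
  mu.-integrable D (EFin \o (fun x => complex.Im (f x * (g x)^*))).
Proof.
move=> [mf f2] [mg g2].
apply: (le_integrable mD _ _ (integrableD mD f2 g2)).
  by apply/measurable_EFinP; apply: (cmeasM mf (cmeasJ mg)).2.
move=> x Dx; rewrite /= lee_fin [leRHS]ger0_norm ?(addr_ge0 (nsq_ge0 _) (nsq_ge0 _))//.
by rewrite -(nsqJ (g x)) normr_Im_mul.
Qed.

Lemma ipDl f g h : L2 f -> L2 g -> L2 h ->
  ip (fun x => f x + g x) h = ip f h + ip g h.
Proof.
move=> Lf Lg Lh; apply: complex_ext; rewrite ?cReD ?cImD /=.
  rewrite -RintegralD//; [|exact: L2_Re_integrable..].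
  by apply: eq_Rintegral => x _; rewrite mulrDl cReD.
rewrite -RintegralD//; [|exact: L2_Im_integrable..].
by apply: eq_Rintegral => x _; rewrite mulrDl cImD.
Qed.

Lemma ipZl c f h : L2 f -> L2 h -> ip (fun x => c * f x) h = c * ip f h.
Proof.
move=> Lf Lh; have iR := L2_Re_integrable Lf Lh; have iI := L2_Im_integrable Lf Lh.
have iZ (k : R) (u : T -> R) : mu.-integrable D (EFin \o u) ->
    mu.-integrable D (EFin \o (fun x => k * u x)).
  by move=> iu; rewrite (_ : _ \o _ = (fun x => k%:E * (u x)%:E)%E)//; exact: integrableZl.
apply: complex_ext; rewrite ?cReM ?cImM /= -!RintegralZl//.
  rewrite -RintegralB//; [|exact: iZ..].
  by apply: eq_Rintegral => x _; rewrite -mulrA cReM.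
rewrite -RintegralD//; [|exact: iZ..].
by apply: eq_Rintegral => x _; rewrite -mulrA cImM.
Qed.

Lemma ipC f g : L2 f -> L2 g -> ip g f = (ip f g)^*.
Proof.
move=> Lf Lg; apply: complex_ext; rewrite ?cReJ ?cImJ /=.
  by apply: eq_Rintegral => x _; rewrite mulrC -cReJ rmorphM /= conjCK.
rewrite -[RHS]mulN1r -RintegralZl//; last exact: L2_Im_integrable.
by apply: eq_Rintegral => x _; rewrite mulN1r -cImJ rmorphM /= conjCK mulrC.
Qed.

Lemma ipE f : ip f f = (\int[mu]_(x in D) nsq (f x))%:C%C.
Proof.
apply: complex_ext => /=; first by apply: eq_Rintegral => x _; rewrite -nsqE.
under eq_Rintegral do rewrite -nsqE /=.
by rewrite Rintegral_cst// mul0r.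
Qed.

Lemma ip_ae_eq f f' g : cmeas f -> cmeas f' -> cmeas g ->
  {ae mu, forall x, D x -> f x = f' x} -> ip f g = ip f' g.
Proof.
move=> mf mf' mg ff'; have m1 := cmeasM mf (cmeasJ mg); have m2 := cmeasM mf' (cmeasJ mg).
rewrite /ip /cintegral /Rintegral; congr (fine _ +i* fine _)%C; apply: ae_eq_integral => //.
- by apply/measurable_EFinP; exact: m1.1.
- by apply/measurable_EFinP; exact: m2.1.
- by apply: filterS ff' => x ff' Dx /=; rewrite ff'.
- by apply/measurable_EFinP; exact: m1.2.
- by apply/measurable_EFinP; exact: m2.2.
- by apply: filterS ff' => x ff' Dx /=; rewrite ff'.
Qed.

Lemma ip_eq0 f : L2 f -> ip f f = 0 -> {ae mu, forall x, D x -> f x = 0}.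
Proof.
move=> [mf f2] /eqP; rewrite ipE -[0]/(0%:C)%C => /eqP[] f0.
have : (\int[mu]_(x in D) `|(nsq (f x))%:E| = 0)%E.
  under eq_integral => x _ do rewrite /= ger0_norm ?nsq_ge0//.
  by rewrite -[LHS]fineK ?integrable_fin_num// -[fine _]/(Rintegral _ _ _) f0.
move=> /ae_eq_integral_abs -/(_ mD) H.
have {}H := H (measurable_int _ f2).
apply: filterS H => x H Dx; have /= [/eqP] := H Dx.
by rewrite nsq_eq0 => /eqP.
Qed.

End L2.

Section Hilbert.
Context d (T : measurableType d) (R : realType) (mu : {measure set T -> \bar R}).
Variables (D : set T) (mD : measurable D).
Implicit Types f g h : T -> R[i].
Local Notation L2 := (L2 mu D).
Local Notation ip := (ip mu D).

(** The squared L2 norm: no root is taken. *)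
Definition nrm f : R := \int[mu]_(x in D) nsq (f x).

Lemma nrm_ge0 f : 0 <= nrm f.
Proof. by apply: Rintegral_ge0 => x _; exact: nsq_ge0. Qed.

Lemma ip_nrm f : ip f f = (nrm f)%:C%C.
Proof. exact: ipE. Qed.

Lemma ipNl f h : L2 f -> L2 h -> ip (fun x => - f x) h = - ip f h.
Proof.
by move=> Lf Lh; rewrite -mulN1r -ipZl//; under eq_fun do rewrite -mulN1r.
Qed.

Lemma ipBl f g h : L2 f -> L2 g -> L2 h ->
  ip (fun x => f x - g x) h = ip f h - ip g h.
Proof. by move=> Lf Lg Lh; rewrite ipDl ?ipNl//; exact: L2N. Qed.

Lemma ipBr f g h : L2 f -> L2 g -> L2 h ->
  ip h (fun x => f x - g x) = ip h f - ip h g.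
Proof.
move=> Lf Lg Lh; rewrite (ipC mD (L2B mD Lf Lg) Lh) ipBl//.
by rewrite (ipC mD Lf Lh) (ipC mD Lg Lh) rmorphB.
Qed.

Lemma ipZr c f h : L2 f -> L2 h -> ip h (fun x => c * f x) = c^* * ip h f.
Proof.
by move=> Lf Lh; rewrite (ipC mD (L2Z mD c Lf) Lh) (ipC mD Lf Lh) ipZl// rmorphM.
Qed.

Lemma ip_suml (I : Type) (r : seq I) (F : I -> T -> R[i]) h :
  (forall i, L2 (F i)) -> L2 h ->
  ip (fun x => \sum_(i <- r) F i x) h = \sum_(i <- r) ip (F i) h.
Proof.
move=> LF Lh; elim: r => [|i r IH].
  rewrite big_nil; under eq_fun do rewrite big_nil -(mul0r 0).
  by rewrite ipZl ?mul0r//; exact: L20.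
rewrite big_cons -IH; under eq_fun do rewrite big_cons.
by rewrite ipDl//; exact: L2_sum.
Qed.

Lemma ip_sumr (I : Type) (r : seq I) (F : I -> T -> R[i]) h :
  (forall i, L2 (F i)) -> L2 h ->
  ip h (fun x => \sum_(i <- r) F i x) = \sum_(i <- r) ip h (F i).
Proof.
move=> LF Lh; rewrite ipC//; last exact: L2_sum.
by rewrite ip_suml// rmorph_sum; apply: eq_bigr => i _; rewrite [RHS]ipC.
Qed.

Lemma nrm_subZ c f g : L2 f -> L2 g ->
  nrm (fun x => f x - c * g x) =
  nrm f - 2 * complex.Re (c^* * ip f g) + nsq c * nrm g.
Proof.
move=> Lf Lg; have Lcg := L2Z mD c Lg; apply: complexI.
rewrite -ip_nrm ipBr//; last exact: L2B.
rewrite !ipBl// !ipZr// !ipZl// !ip_nrm (ipC mD Lf Lg).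
set z := ip f g; apply: complex_ext.
  by rewrite /= !cReD !cReN !cReD !cReN !cReM !cImM !cReJ !cImJ /= /nsq; ring.
by rewrite /= !cImD !cImN !cImD !cImN !cImM !cReM !cReJ !cImJ /=; ring.
Qed.

(** With z the inner product, the squared norm of f - t z g is nonnegative for every real t. The
    best t is the inverse of [nrm g]; if [nrm g] is 0, a large t forces z = 0. *)
Lemma cauchy_schwarz f g : L2 f -> L2 g -> nsq (ip f g) <= nrm f * nrm g.
Proof.
move=> Lf Lg; set z := ip f g.
have H (t : R) : 0 <= nrm f - 2 * t * nsq z + t ^+ 2 * nsq z * nrm g.
  have := nrm_ge0 (fun x => f x - t%:C%C * z * g x).
  rewrite nrm_subZ// -/z nsqM.
  have -> : complex.Re ((t%:C%C * z)^* * z) = t * nsq z.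
    by case: z => a b; rewrite cReM cReJ cImJ cReM cImM /nsq /=; ring.
  have -> : nsq t%:C%C = t ^+ 2 by rewrite /nsq /= expr0n addr0.
  by rewrite mulrA.
have [z0|z0] := eqVneq (nsq z) 0; first by rewrite z0 mulr_ge0 ?nrm_ge0.
have {z0} zp : 0 < nsq z by rewrite lt_neqAle eq_sym z0 nsq_ge0.
have [g0|g0] := eqVneq (nrm g) 0.
  have := H ((nrm f + 1) / nsq z); rewrite g0 mulr0 addr0 -mulrA divfK ?gt_eqF//.
  by have := nrm_ge0 f; lra.
have {}g0 : 0 < nrm g by rewrite lt_neqAle eq_sym g0 nrm_ge0.
have := H (nrm g)^-1; rewrite -(pmulr_lge0 _ g0).
suff -> : (nrm f - 2 / nrm g * nsq z + (nrm g)^-1 ^+ 2 * nsq z * nrm g) * nrm g =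
          nrm f * nrm g - nsq z by rewrite subr_ge0.
by field; rewrite gt_eqF.
Qed.

Section Orthonormal.
Variables (n : nat) (e : 'I_n -> T -> R[i]).
Hypothesis Le : forall i, L2 (e i).
Hypothesis orthonormal : forall i j, ip (e i) (e j) = (i == j)%:R.

Definition comb (c : 'I_n -> R[i]) x := \sum_i c i * e i x.

Lemma L2_comb c : L2 (comb c).
Proof. by apply: L2_sum => // i _; exact: L2Z. Qed.

Lemma ip_comb c j : ip (comb c) (e j) = c j.
Proof.
rewrite ip_suml//; last by move=> i; exact: L2Z.
under eq_bigr do rewrite ipZl// orthonormal.
rewrite (bigD1 j)//= eqxx mulr1 big1 ?addr0// => i ij.
by rewrite (negbTE ij) mulr0.
Qed.

Definition residual f x := f x - comb (fun i => ip f (e i)) x.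

Lemma L2_residual f : L2 f -> L2 (residual f).
Proof. by move=> Lf; apply: L2B => //; exact: L2_comb. Qed.

Lemma residual_orth f j : L2 f -> ip (residual f) (e j) = 0.
Proof.
by move=> Lf; rewrite ipBl// ?ip_comb ?subrr//; exact: L2_comb.
Qed.

Lemma residual_orth_comb f c : L2 f -> ip (residual f) (comb c) = 0.
Proof.
move=> Lf; rewrite ip_sumr//; last 2 first.
- by move=> i; exact: L2Z.
- exact: L2_residual.
rewrite big1// => i _; rewrite ipZr ?residual_orth ?mulr0//.
exact: L2_residual.
Qed.

Lemma nrm_residual f : L2 f ->
  nrm (residual f) = nrm f - \sum_i nsq (ip f (e i)).
Proof.
move=> Lf; apply: complexI; have Lc := L2_comb (fun i => ip f (e i)).
rewrite -ip_nrm ipBr//; last exact: L2_residual.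
rewrite residual_orth_comb// subr0 ipBl// ip_nrm rmorphB; congr (_ - _).
rewrite ip_suml//; last by move=> i; exact: L2Z.
rewrite rmorph_sum; apply: eq_bigr => i _.
by rewrite ipZl// (ipC mD Lf)//; exact/esym/nsqE.
Qed.

End Orthonormal.
End Hilbert.

(** * Trigonometric functions on the torus *)

Section TorusIntegral.
Variable R : realType.
Local Notation C := R[i].
Local Notation mu := (@leb R).
Local Notation D := (@torus R).

Lemma borel_lebesgue (B : set (measurableTypeR R)) :
  measurable B -> measurable (B : set (lebesgueType R)).
Proof. exact: sub_caratheodory. Qed.

Lemma leb_borel (B : set (measurableTypeR R)) :
  leb R B = lebesgue_measure B.
Proof. by []. Qed.

Lemma measurable_torus : measurable D.
Proof. by apply: borel_lebesgue; exact: measurable_itv. Qed.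
Hint Resolve measurable_torus : core.
Let mD := measurable_torus.

Lemma leb_torus : leb R D = 1%E.
Proof.
by rewrite /torus leb_borel lebesgue_measure_itv /= lte01 oppr0 adde0.
Qed.

Lemma measurable_fun_borel (E : set (lebesgueType R)) (g : R -> R) :
  measurable_fun setT (g : measurableTypeR R -> measurableTypeR R) ->
  measurable_fun E (g : lebesgueType R -> R).
Proof.
move=> mg; apply: measurable_funTS => _ B mB; rewrite setTI.
by apply: borel_lebesgue; rewrite -[_ @^-1` _]setTI; exact: mg.
Qed.

(** The identity from Lebesgue sets to Borel sets is measurable and carries [leb] to
    [lebesgue_measure], so that the integral of a nonnegative function can be pushed forward. This
    opens the way to the fundamental theorem of calculus on the torus. *)
Lemma integral_leb (B : set (measurableTypeR R)) (f : measurableTypeR R -> \bar R) :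
  measurable B -> measurable_fun setT f ->
  (\int[mu]_(t in B) f t = \int[lebesgue_measure]_(t in B) f t)%E.
Proof.
move=> mB mf; pose phi : lebesgueType R -> measurableTypeR R := id.
have mphi : measurable_fun setT phi.
  by move=> _ E mE; rewrite setTI; exact: borel_lebesgue.
have H (h : measurableTypeR R -> \bar R) : measurable_fun setT h ->
    (forall x, 0 <= h x)%E ->
    (\int[mu]_(t in B) h t = \int[lebesgue_measure]_(t in B) h t)%E.
  move=> mh h0; rewrite -[LHS](ge0_integral_pushforward mphi mu)//.
  exact: measurable_funTS.
rewrite integralE [RHS]integralE; congr (_ - _)%E.
  by apply: H => //; exact: measurable_funepos.
by apply: H => //; exact: measurable_funeneg.
Qed.

Lemma Rintegral_torus (g : R -> R) :
  continuous g -> \int[mu]_(t in D) g t = \int[lebesgue_measure]_(t in `[0, 1]) g t.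
Proof.
move=> cg.
have mg : measurable_fun setT (g : measurableTypeR R -> measurableTypeR R).
  exact: continuous_measurable_fun.
have mEg : measurable_fun setT (EFin \o (g : measurableTypeR R -> R)).
  exact/measurable_EFinP.
rewrite /Rintegral; congr fine.
rewrite [LHS](integral_leb (measurable_itv `[0, 1[) mEg).
rewrite integral_itv_bndo_bndc//.
by apply/measurable_EFinP; exact: measurable_funTS.
Qed.

Lemma leb_set1 (a : R) : leb R [set a] = 0%E.
Proof. by rewrite leb_borel lebesgue_measure_set1. Qed.

Lemma integral_torus_derivative (F g : R -> R) :
  continuous g -> (forall x : R, is_derive x 1 F (g x)) -> F 0 = F 1 ->
  \int[mu]_(t in D) g t = 0.
Proof.
move=> cg dF F01; rewrite Rintegral_torus// /Rintegral.
have cF : continuous F.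
  move=> x; apply/differentiable_continuous/derivable1_diffP.
  by have [] := dF x.
rewrite (@continuous_FTC2 _ g F) ?ltr01//.
- by rewrite F01 subee.
- exact: continuous_subspaceT.
- split.
  + by move=> x _; have [] := dF x.
  + exact/cvg_at_right_filter/cF.
  + exact/cvg_at_left_filter/cF.
- by move=> x _; rewrite derive1E; have [_ ->] := dF x.
Qed.

Lemma cisD (x y : R) : cis (x + y) = cis x * cis y.
Proof.
by apply: complex_ext; rewrite ?cReM ?cImM /= ?cosD ?sinD//; ring.
Qed.

Lemma cisN (x : R) : cis (- x) = (cis x)^*.
Proof. by apply: complex_ext; rewrite ?cReJ ?cImJ /= ?cosN ?sinN. Qed.

Lemma nsq_cis (x : R) : nsq (cis x) = 1.
Proof. exact: cos2Dsin2. Qed.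

Lemma cis0 : cis 0 = 1 :> C.
Proof. by rewrite /cis cos0 sin0. Qed.

Definition trig (n : int) (t : R) : C := cis (2 * pi * n%:~R * t).

Lemma trigD m n t : trig (m + n) t = trig m t * trig n t.
Proof. by rewrite /trig -cisD intrD; congr cis; ring. Qed.

Lemma trigN n t : trig (- n) t = (trig n t)^*.
Proof. by rewrite /trig -cisN intrN; congr cis; ring. Qed.

Lemma trig0 t : trig 0 t = 1.
Proof. by rewrite /trig mulr0 mul0r cis0. Qed.

Lemma trig_1 n : trig n 1 = 1.
Proof.
suff H (m : nat) : trig m 1 = 1.
  case: n => m; first exact: H.
  by rewrite NegzE trigN H conjC1.
elim: m => [|m IH]; first exact: trig0.
rewrite -addn1 PoszD trigD IH mul1r /trig mulr1z !mulr1 /cis mulr_natl.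
by rewrite cos2pi sin2pi.
Qed.

Lemma continuous_cos_lin (a : R) : continuous (fun t : R => cos (a * t)).
Proof.
move=> t; apply: continuous_comp; last exact: continuous_cos.
exact: mulrl_continuous.
Qed.

Lemma continuous_sin_lin (a : R) : continuous (fun t : R => sin (a * t)).
Proof.
move=> t; apply: continuous_comp; last exact: continuous_sin.
exact: mulrl_continuous.
Qed.

Lemma integral_trig (n : int) : n != 0 -> cintegral mu D (trig n) = 0.
Proof.
move=> n0; set a : R := 2 * pi * n%:~R.
have a0 : a != 0 by rewrite !mulf_neq0 ?intr_eq0// gt_eqF// pi_gt0.
have [ca sa] : cos a = 1 /\ sin a = 0.
  by have := trig_1 n; rewrite /trig mulr1 -/a => -[].
apply: complex_ext => /=.
  apply: (@integral_torus_derivative (fun t => a^-1 * sin (a * t))).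
  - exact: continuous_cos_lin.
  - move=> t; apply: is_derive_eq.
    by rewrite /GRing.scale /= !mulr1; field.
  - by rewrite mulr1 sa mulr0 sin0 mulr0.
apply: (@integral_torus_derivative (fun t => - a^-1 * cos (a * t))).
- exact: continuous_sin_lin.
- move=> t; apply: is_derive_eq.
  by rewrite /GRing.scale /= !mulr1; field.
- by rewrite mulr1 ca mulr0 cos0.
Qed.


Local Notation L2 := (L2 mu D).
Local Notation ip := (ip mu D).
Local Notation nrm := (nrm mu D).

Lemma is_L2E (f : lebesgueType R -> C) : is_L2 f <-> L2 f.
Proof.
have E : (\int[mu]_(t in D) (Normc.normc (f t) ^+ 2)%:E =
          \int[mu]_(t in D) `|(nsq (f t))%:E|)%E.
  by apply: eq_integral => t _; rewrite normc_sqr /= ger0_norm// nsq_ge0.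
split=> [[m1 m2]|[[m1 m2] /integrableP[_ +]]].
  rewrite E => H; split; first by split.
  by apply/integrableP; split => //; apply/measurable_EFinP; exact: cmeas_nsq.
by move=> H; split => //; rewrite E.
Qed.

Lemma cmeas_trig n (E : set (lebesgueType R)) : cmeas E (trig n).
Proof.
split; apply: measurable_fun_borel; apply: continuous_measurable_fun.
  exact: continuous_cos_lin.
exact: continuous_sin_lin.
Qed.

Lemma integrable_torus_cst (k : R) : mu.-integrable D (EFin \o fun=> k).
Proof.
apply/integrableP; split; first exact/measurable_EFinP/measurable_cst.
rewrite integral_cst//= leb_torus mule1; exact: ltry.
Qed.

Lemma L2_bounded (f : lebesgueType R -> C) (K : R) : cmeas D f ->
  (forall t, D t -> nsq (f t) <= K) -> L2 f.
Proof. by move=> mf fK; exact: (L2_dominated mD mf (integrable_torus_cst K)). Qed.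

Lemma L2_trig n : L2 (trig n).
Proof.
apply: (@L2_bounded _ 1); first exact: cmeas_trig.
by move=> t _; rewrite nsq_cis.
Qed.

Lemma ip_trig m n : ip (trig m) (trig n) = (m == n)%:R.
Proof.
have -> : ip (trig m) (trig n) = cintegral mu D (trig (m - n)).
  by congr cintegral; apply/funext => t; rewrite trigD trigN.
have [->|mn] := eqVneq m n; last by rewrite integral_trig// subr_eq0.
rewrite subrr; apply: complex_ext => /=.
  under eq_Rintegral do rewrite !(mulr0, mul0r) cos0.
  by rewrite Rintegral_cst// leb_torus mulr1.
under eq_Rintegral do rewrite !(mulr0, mul0r) sin0.
by rewrite Rintegral_cst// mul0r.
Qed.

Lemma fourierE (f : lebesgueType R -> C) n : fourier f n = ip f (trig n).
Proof. by congr torus_integral; apply/funext => t; rewrite cisN. Qed.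

Section Toeplitz.
Variables (A : set (lebesgueType R)) (mA : measurable A).

Lemma cmeas_charfun (E : set (lebesgueType R)) : cmeas E (charfun A).
Proof.
split; last exact: measurable_cst.
by apply: measurable_funTS; exact: measurable_indic.
Qed.

Lemma nsq_charfun t : nsq (charfun A t) <= 1.
Proof.
rewrite /nsq /charfun /= indicE; case: (_ \in _); rewrite ?expr1n ?expr0n/= ?addr0//.
Qed.

Definition cut_by (f : lebesgueType R -> C) t := charfun A t * f t.

Lemma L2_cut f : L2 f -> L2 (cut_by f).
Proof.
apply: (@L2_mul_bounded _ _ _ mu _ mD 1); first exact: cmeas_charfun.
by move=> t _; exact: nsq_charfun.
Qed.

Lemma ip_cut f g : ip (cut_by f) (cut_by g) = ip (cut_by f) g.
Proof.
congr cintegral; apply/funext => t; rewrite /cut_by /charfun indicE.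
by case: (_ \in _); rewrite ?mul1r// !mul0r.
Qed.

(** Up to transposition, Q is the matrix in the trigonometric basis of multiplication by the
    indicator of A, an orthogonal projection. *)
Lemma toeplitzE j k : toeplitz A j k = ip (cut_by (trig j)) (trig k).
Proof.
rewrite /toeplitz fourierE; congr cintegral; apply/funext => t.
by rewrite /cut_by trigD trigN rmorphM /= conjCK -mulrA [trig j t * _]mulrC.
Qed.

Lemma toeplitz_herm j k : toeplitz A k j = (toeplitz A j k)^*.
Proof.
have Lj := L2_trig j; have Lk := L2_trig k.
rewrite !toeplitzE -(ip_cut (trig k) (trig j)) -(ip_cut (trig j) (trig k)).
exact: (ipC mD (L2_cut Lj) (L2_cut Lk)).
Qed.

Section Finite.
Variables (n : nat) (e : 'I_n -> int) (c : 'cV[C]_n).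
Hypothesis injE : injective e.

(** The coefficients are conjugated so that the window Fourier coefficients of the cut-off are the
    conjugates of the entries of Q c, with Q acting on columns. *)
Definition trig_poly := comb (fun i => trig (e i)) (fun i => (c i 0)^*).

Lemma L2_trig_poly : L2 trig_poly.
Proof. exact: (L2_comb mD (fun i => L2_trig (e i))). Qed.

Lemma ip_cut_trig_poly i :
  ip (cut_by trig_poly) (trig (e i)) = ((sub_mx (toeplitz A) e *m c) i 0)^*.
Proof.
have -> : cut_by trig_poly = fun t => \sum_j (c j 0)^* * cut_by (trig (e j)) t.
  apply/funext => t; rewrite /cut_by /trig_poly /comb mulr_sumr.
  by apply: eq_bigr => j _; rewrite mulrCA.
have LF j : L2 (fun t => (c j 0)^* * cut_by (trig (e j)) t).
  exact: (L2Z mD _ (L2_cut (L2_trig _))).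
rewrite (ip_suml mD _ LF (L2_trig _)) mxE rmorph_sum; apply: eq_bigr => j _.
rewrite (ipZl mD _ (L2_cut (L2_trig _)) (L2_trig _)).
by rewrite -toeplitzE mxE rmorphM toeplitz_herm mulrC.
Qed.

(** The energy is the product of Q c with c minus that of Q c with itself. The former is the squared
    norm of the cut-off polynomial, as the cut-off is a projection; the latter is the sum of the
    squared moduli of its window coefficients. Pythagoras gives the difference. *)
Lemma energy_residual :
  energy (sub_mx (toeplitz A) e) c =
  (nrm (residual mu D (fun i => trig (e i)) (cut_by trig_poly)))%:C%C.
Proof.
have Lc := L2_cut L2_trig_poly.
have Le i : L2 (trig (e i)) by exact: L2_trig.
have oe i j : ip (trig (e i)) (trig (e j)) = (i == j)%:R.
  by rewrite ip_trig (inj_eq injE).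
have LF i : L2 (fun t => (c i 0)^* * trig (e i) t) by exact: (L2Z mD _ (Le i)).
rewrite (nrm_residual mD Le oe Lc).
transitivity ((nrm (cut_by trig_poly))%:C%C -
    \sum_i (nsq (ip (cut_by trig_poly) (trig (e i))))%:C%C); last first.
  by rewrite rmorphB rmorph_sum.
rewrite -(ip_nrm mu mD) ip_cut (ip_sumr mD _ LF Lc) -sumrB; apply: eq_bigr => i _.
rewrite (ipZr mD _ (Le i) Lc) nsqE ip_cut_trig_poly.
have subE (u v : 'cV[C]_n) : (u - v) i 0 = u i 0 - v i 0 by rewrite !mxE.
rewrite !conjCK mulmxBl mul1mx subE mulrBr.
by rewrite [c i 0 * _]mulrC.
Qed.

Lemma energy_ge0 : 0 <= energy (sub_mx (toeplitz A) e) c.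
Proof. by rewrite energy_residual ler0c nrm_ge0. Qed.

End Finite.
End Toeplitz.
End TorusIntegral.

(** * Density of trigonometric polynomials *)

Section Density.
Variable R : realType.
Local Notation C := R[i].
Local Notation mu := (@leb R).
Local Notation D := (@torus R).
Local Notation L2 := (L2 mu D).
Local Notation ip := (ip mu D).
Local Notation nrm := (nrm mu D).
Let mD : measurable D := @measurable_torus R.
Implicit Types f g h p : lebesgueType R -> C.

(** Frequencies are taken in the order of [int_enum], so that a sum of n terms has all of them in
    the window of size n and in every larger one. *)
Definition trigsum n (c : nat -> C) t := \sum_(i < n) c i * trig (int_enum i) (t : R).

Definition trigonometric p := exists n c, forall t, p t = trigsum n c t.

Lemma trigsum_widen m n c t : (m <= n)%N ->
  trigsum m c t = trigsum n (fun i => if (i < m)%N then c i else 0) t.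
Proof.
move=> mn; rewrite /trigsum (big_ord_widen n (fun i => c i * trig (int_enum i) t))//.
by rewrite big_mkcond; apply: eq_bigr => i _; case: ifP => // _; rewrite mul0r.
Qed.

Lemma trigonometric_trig k : trigonometric (trig k).
Proof.
exists (int_rank k).+1, (fun i => (i == int_rank k)%:R) => t.
rewrite /trigsum big_ord_recr /= eqxx mul1r int_rankK big1 ?add0r// => i _.
by rewrite ltn_eqF ?mul0r.
Qed.

Lemma trigonometricD p q : trigonometric p -> trigonometric q ->
  trigonometric (fun t => p t + q t).
Proof.
move=> [m [c pE]] [n [b qE]]; exists (maxn m n),
  (fun i => (if (i < m)%N then c i else 0) + (if (i < n)%N then b i else 0)) => t.
rewrite pE qE (trigsum_widen c t (leq_maxl m n)) (trigsum_widen b t (leq_maxr m n)).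
by rewrite /trigsum -big_split; apply: eq_bigr => i _ /=; rewrite -mulrDl.
Qed.

Lemma trigonometricZ a p : trigonometric p -> trigonometric (fun t => a * p t).
Proof.
move=> [m [c pE]]; exists m, (fun i => a * c i) => t.
by rewrite pE mulr_sumr; apply: eq_bigr => i _; rewrite mulrA.
Qed.

Lemma trigonometric_cst a : trigonometric (fun=> a).
Proof.
have [n [c cE]] := trigonometricZ a (trigonometric_trig 0).
by exists n, c => t; rewrite -cE trig0 mulr1.
Qed.

Lemma trigonometric_sum (I : Type) (r : seq I) (F : I -> R -> C) :
  (forall i, trigonometric (F i)) -> trigonometric (fun t => \sum_(i <- r) F i t).
Proof.
move=> TF; elim: r => [|i r [n [c IH]]].
  have [n [c cE]] := trigonometric_cst 0.
  by exists n, c => t; rewrite -cE big_nil.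
have [||m [b bE]] := @trigonometricD (F i) (fun t => \sum_(j <- r) F j t) => //.
  by exists n, c.
by exists m, b => t; rewrite big_cons -bE.
Qed.

Lemma trigonometricM p q : trigonometric p -> trigonometric q ->
  trigonometric (fun t => p t * q t).
Proof.
move=> [m [c pE]] [n [b qE]].
have H (i : 'I_m) : trigonometric (fun t => \sum_(j < n) c i * b j * trig (int_enum i + int_enum j) t).
  by apply: trigonometric_sum => j; apply: trigonometricZ; exact: trigonometric_trig.
have [k [a aE]] := trigonometric_sum (index_enum 'I_m) H.
exists k, a => t; rewrite -aE pE qE /trigsum mulr_suml; apply: eq_bigr => i _.
by rewrite mulr_sumr; apply: eq_bigr => j _; rewrite trigD mulrACA.
Qed.

Lemma trigonometricX p n : trigonometric p -> trigonometric (fun t => p t ^+ n).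
Proof.
move=> Tp; elim: n => [|n IH]; first exact: trigonometric_cst.
have [k [a aE]] := trigonometricM Tp IH.
by exists k, a => t; rewrite exprS aE.
Qed.

Lemma L2_trigonometric p : trigonometric p -> L2 p.
Proof.
move=> [n [c pE]]; rewrite (_ : p = trigsum n c); last exact/funext.
have LF (i : 'I_n) : xpredT i -> L2 (fun t => c i * trig (int_enum i) t).
  by move=> _; exact: (L2Z mD _ (L2_trig R _)).
exact: (L2_sum mD (index_enum 'I_n) LF).
Qed.

Definition trig_dense f := L2 f /\
  forall eps : R, 0 < eps -> exists2 p, trigonometric p & nrm (fun t => f t - p t) < eps.

Lemma nrm_eq f g : cmeas D f -> cmeas D g ->
  {ae mu, forall t, D t -> f t = g t} -> nrm f = nrm g.
Proof.
move=> mf mg fg; rewrite /nrm /Rintegral; congr fine; apply: ae_eq_integral.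
- exact: mD.
- by apply/measurable_EFinP; exact: cmeas_nsq.
- by apply/measurable_EFinP; exact: cmeas_nsq.
- by apply: filterS fg => t fg Dt /=; rewrite fg.
Qed.

Lemma nrmD_le f g : L2 f -> L2 g ->
  nrm (fun t => f t + g t) <= 2 * nrm f + 2 * nrm g.
Proof.
move=> Lf Lg; have [_ f2] := Lf; have [_ g2] := Lg; have [_ fg2] := L2D mD Lf Lg.
have iZ (u : lebesgueType R -> R) : mu.-integrable D (EFin \o u) ->
    mu.-integrable D (EFin \o (fun x => 2 * u x)).
  by move=> iu; rewrite (_ : _ \o _ = (fun x => 2%R%:E * (u x)%:E)%E)//; exact: integrableZl.
rewrite /nrm -!RintegralZl// -RintegralD//; [|exact: iZ..].
apply: le_Rintegral => //; last by move=> t _; exact: nsqD_le.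
exact: (integrableD mD (iZ _ f2) (iZ _ g2)).
Qed.

Lemma dense_trigonometric p : trigonometric p -> trig_dense p.
Proof.
move=> Tp; split; first exact: L2_trigonometric.
move=> eps e0; exists p => //; rewrite /nrm.
under eq_Rintegral do rewrite subrr.
by rewrite /nsq /= expr0n addr0 Rintegral_cst// mul0r.
Qed.

Lemma dense_lim f : L2 f ->
  (forall eps : R, 0 < eps -> exists2 g, trig_dense g & nrm (fun t => f t - g t) < eps) ->
  trig_dense f.
Proof.
move=> Lf H; split=> // eps e0.
have e4 : 0 < eps / 4 by rewrite divr_gt0.
have [g [Lg dg] fg] := H _ e4; have [p Tp gp] := dg _ e4; exists p => //.
have Lp := L2_trigonometric Tp.
have -> : (fun t => f t - p t) = (fun t => (f t - g t) + (g t - p t)).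
  by apply/funext => t; rewrite addrA subrK.
apply: (le_lt_trans (nrmD_le (L2B mD Lf Lg) (L2B mD Lg Lp))); lra.
Qed.

Lemma denseD f g : trig_dense f -> trig_dense g -> trig_dense (fun t => f t + g t).
Proof.
move=> [Lf df] [Lg dg]; split; first exact: (L2D mD Lf Lg).
move=> eps e0; have e4 : 0 < eps / 4 by rewrite divr_gt0.
have [p Tp fp] := df _ e4; have [q Tq gq] := dg _ e4.
exists (fun t => p t + q t); first exact: trigonometricD.
have -> : (fun t => f t + g t - (p t + q t)) = (fun t => (f t - p t) + (g t - q t)).
  by apply/funext => t; rewrite opprD addrACA.
have Lfp := L2B mD Lf (L2_trigonometric Tp).
have Lgq := L2B mD Lg (L2_trigonometric Tq).
apply: (le_lt_trans (nrmD_le Lfp Lgq)); lra.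
Qed.

Lemma nrmZ a f : L2 f -> nrm (fun t => a * f t) = nsq a * nrm f.
Proof.
move=> [_ f2]; rewrite /nrm -RintegralZl//.
by apply: eq_Rintegral => t _; rewrite nsqM.
Qed.

Lemma denseZ a f : trig_dense f -> trig_dense (fun t => a * f t).
Proof.
move=> [Lf df]; split; first exact: (L2Z mD a Lf).
move=> eps e0; have a0 : 0 < nsq a + 1 by rewrite ltr_wpDl ?nsq_ge0.
have [|p Tp fp] := df (eps / (nsq a + 1)); first by rewrite divr_gt0.
exists (fun t => a * p t); first exact: trigonometricZ.
have -> : (fun t => a * f t - a * p t) = (fun t => a * (f t - p t)).
  by apply/funext => t; rewrite mulrBr.
have Lfp := L2B mD Lf (L2_trigonometric Tp).
rewrite nrmZ//; rewrite ltr_pdivlMr// in fp.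
by apply: le_lt_trans fp; rewrite mulrC ler_wpM2l ?nrm_ge0// lerDl.
Qed.

Lemma denseB f g : trig_dense f -> trig_dense g -> trig_dense (fun t => f t - g t).
Proof.
move=> df /(denseZ (-1)) dg; have := denseD df dg.
by under eq_fun do rewrite mulN1r.
Qed.

Lemma dense_ae f g : trig_dense f -> cmeas D g ->
  {ae mu, forall t, D t -> f t = g t} -> trig_dense g.
Proof.
move=> df mg fg; have [[mf f2] _] := df.
have Lg : L2 g.
  split=> //; apply/integrableP; split.
    by apply/measurable_EFinP; exact: cmeas_nsq.
  move/integrableP : f2 => [_]; suff -> : (\int[mu]_(t in D) `|(EFin \o (fun t => nsq (f t))) t| =
             \int[mu]_(t in D) `|(EFin \o (fun t => nsq (g t))) t|)%E by [].
  apply: ae_eq_integral.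
  - exact: mD.
  - by apply/measurableT_comp => //; apply/measurable_EFinP; exact: cmeas_nsq.
  - by apply/measurableT_comp => //; apply/measurable_EFinP; exact: cmeas_nsq.
  - by apply: filterS fg => t fg Dt /=; rewrite fg.
apply: dense_lim => // eps e0; exists f => //.
rewrite (@nrm_eq _ (fun=> 0)).
- rewrite /nrm; under eq_Rintegral do rewrite /nsq /= expr0n addr0.
  by rewrite Rintegral_cst// mul0r.
- have := cmeasM (cmeas_cst D (-1)) mf; move/(cmeasD mg).
  by under eq_fun do rewrite mulN1r.
- exact: cmeas_cst.
- by apply: filterS fg => t fg Dt; rewrite fg// subrr.
Qed.

(** Dominated convergence for the squared distance, combined with the stability of approximable
    functions under L2 limits; the later passages to the limit all rest on it. *)
Lemma dense_dominated (F : nat -> lebesgueType R -> C) f (u : lebesgueType R -> R) :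
  (forall n, trig_dense (F n)) -> L2 f -> mu.-integrable D (EFin \o u) ->
  (forall n t, D t -> nsq (f t - F n t) <= u t) ->
  {ae mu, forall t, D t -> nsq (f t - F n t) @[n --> \oo] --> (0 : R)} ->
  trig_dense f.
Proof.
move=> dF Lf iu Fu cv; apply: dense_lim => // eps e0.
have LB n : L2 (fun t => f t - F n t) by exact: (L2B mD Lf (dF n).1).
pose h n t := (nsq (f t - F n t))%:E.
have mh n : measurable_fun D (h n) by apply/measurable_EFinP/cmeas_nsq; exact: (LB n).1.
have m0 : measurable_fun D (cst 0%E : lebesgueType R -> \bar R) by exact: measurable_cst.
have h0 : {ae mu, forall t, D t -> h ^~ t @ \oo --> cst 0%E t}.
  by apply: filterS cv => t H Dt; apply: cvg_EFin; [exact: nearW|exact: H].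
have hu : {ae mu, forall t n, D t -> (`|h n t| <= (EFin \o u) t)%E}.
  by apply: aeW => t n Dt; rewrite /= lee_fin ger0_norm ?nsq_ge0//; exact: Fu.
have [_ _] := dominated_convergence mD mh m0 h0 iu hu.
rewrite integral0 => /fine_cvgP[_] /cvgr_lt /(_ _ e0) [N _ /(_ N (leqnn _)) HN].
by exists (F N).
Qed.

Lemma cmeas_real (E : set (lebesgueType R)) (u : lebesgueType R -> R) :
  measurable_fun E u -> cmeas E (fun t => (u t)%:C%C).
Proof. by move=> mu'; split => //; exact: measurable_cst. Qed.

(* the polynomials (1 - x^n)^(2^n) approximate the indicator of [0, 1/2[ *)
Lemma step_poly_lt (x : R) : 0 <= x < 1 / 2 ->
  (1 - x ^+ n) ^+ (2 ^ n) @[n --> \oo] --> (1 : R).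
Proof.
move=> /andP[x0 x1].
(* The lower bound 1 - 2^n x^n is Bernoulli's inequality. *)
have cg : 1 - (2 * x) ^+ n @[n --> \oo] --> (1 : R).
  rewrite -[X in _ --> X]subr0; apply: cvgB; first exact: cvg_cst.
  by apply: cvg_expr; rewrite ger0_norm ?mulr_ge0//; lra.
apply: squeeze_cvgr cg (cvg_cst _); near=> n.
have xn0 : 0 <= x ^+ n by rewrite exprn_ge0.
have xn1 : x ^+ n <= 1 by rewrite exprn_ile1//; lra.
apply/andP; split; last by rewrite exprn_ile1 ?subr_ge0// lerBlDr lerDl.
have bern m (y : R) : 0 <= y <= 1 -> 1 - m%:R * y <= (1 - y) ^+ m.
  move=> /andP[y0 y1]; elim: m => [|m IH]; first by rewrite mul0r subr0 expr0.
  rewrite exprS -natr1; have : 0 <= 1 - y by lra.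
  move=> /(ler_wpM2l)/(_ _ _ IH); apply: le_trans; rewrite -subr_ge0.
  have : 0 <= m%:R * y * y by rewrite !mulr_ge0.
  by lra.
have := @bern (2 ^ n)%N (x ^+ n); rewrite xn0 xn1 => /(_ isT).
by rewrite natrX -exprMn.
Unshelve. all: by end_near. Qed.

Lemma step_poly_gt (x : R) : 1 / 2 < x <= 1 ->
  (1 - x ^+ n) ^+ (2 ^ n) @[n --> \oo] --> (0 : R).
Proof.
move=> /andP[x0 x1]; have xp : 0 < x by lra.
(* As (1 - x^n)(1 + x^n) <= 1, the sequence is at most the inverse of (1 + x^n)^(2^n), which by
   Bernoulli's inequality is at least 2^n x^n. *)
have cg : (2 * x)^-1 ^+ n @[n --> \oo] --> (0 : R).
  by apply: cvg_expr; rewrite ger0_norm ?invr_ge0 ?mulr_ge0 ?invf_lt1//; lra.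
apply: squeeze_cvgr (cvg_cst _) cg; near=> n.
have xn0 : 0 <= x ^+ n by rewrite exprn_ge0// ltW.
have xn1 : x ^+ n <= 1 by rewrite exprn_ile1//; lra.
apply/andP; split; first by rewrite exprn_ge0// subr_ge0.
have bern m (y : R) : 0 <= y -> 1 + m%:R * y <= (1 + y) ^+ m.
  move=> y0; elim: m => [|m IH]; first by rewrite mul0r addr0 expr0.
  rewrite exprS -natr1; have : 0 <= 1 + y by lra.
  move=> /(ler_wpM2l)/(_ _ _ IH); apply: le_trans; rewrite -subr_ge0.
  have : 0 <= m%:R * y * y by rewrite !mulr_ge0.
  by lra.
have := bern (2 ^ n)%N _ xn0; rewrite natrX -exprMn => H.
have p0 : 0 < (2 * x) ^+ n by rewrite exprn_gt0// mulr_gt0.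
rewrite exprVn -[leRHS]mul1r ler_pdivlMr//.
apply: (@le_trans _ _ ((1 - x ^+ n) ^+ (2 ^ n) * (1 + x ^+ n) ^+ (2 ^ n))).
  rewrite ler_wpM2l ?exprn_ge0 ?subr_ge0//; lra.
rewrite -exprMn -subr_sqr expr1n; apply: exprn_ile1.
  by rewrite subr_ge0 exprn_ile1.
by rewrite lerBlDr lerDl sqr_ge0.
Unshelve. all: by end_near. Qed.

End Density.

(** * From arcs to Borel sets, Lebesgue sets and square-integrable functions *)

Section DensityAll.
Import HBNNSimple.
Variable R : realType.
Local Notation C := R[i].
Local Notation mu := (@leb R).
Local Notation D := (@torus R).
Local Notation L2 := (L2 mu D).
Local Notation nrm := (nrm mu D).
Let mD : measurable D := @measurable_torus R.

Lemma L2_charfun (A : set (lebesgueType R)) : measurable A -> L2 (charfun A).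
Proof.
move=> mA; apply: (@L2_bounded _ _ 1); first exact: cmeas_charfun.
by move=> t _; exact: nsq_charfun.
Qed.

(* [bump a] is a trigonometric polynomial with values in [0, 1] that is below
   1/2 exactly on the arc ]0, a[ *)
Definition bump (a t : R) : R :=
  1 / 2 - (cos (2 * pi * t - pi * a) - cos (pi * a)) / 4.

(** The product form shows the sign of [bump a t] - 1/2: for 0 < t < 1 the first sine is positive,
    and the second changes sign at t = a. *)
Lemma bumpE a t : bump a t = 1 / 2 - sin (pi * t) * sin (pi * (a - t)) / 2.
Proof.
have H (u v : R) : cos (u + v) - cos (u - v) = - (2 * (sin u * sin v)).
  by rewrite cosB cosD; ring.
have := H (pi * t) (pi * t - pi * a).
rewrite opprB [pi * t + (pi * a - _)]addrCA subrr addr0.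
have -> : pi * t + (pi * t - pi * a) = 2 * pi * t - pi * a by ring.
have -> : pi * (a - t) = - (pi * t - pi * a) by ring.
by rewrite /bump sinN => ->; field.
Qed.

Lemma bump01 a t : 0 <= bump a t <= 1.
Proof.
rewrite /bump; move: (2 * pi * t - pi * a) => x; move: (pi * a) => y.
have := cos_le1 x; have := cos_geN1 x; have := cos_le1 y; have := cos_geN1 y.
by move=> *; apply/andP; split; lra.
Qed.

Lemma bump_lt a t : a < 1 -> 0 < t < a -> bump a t < 1 / 2.
Proof.
move=> a1 /andP[t0 ta]; rewrite bumpE ltrBlDr ltrDl divr_gt0//.
have H u : 0 < u < 1 -> 0 < sin (pi * u).
  move=> /andP[u0 u1]; apply: sin_gt0_pi.
  by rewrite mulr_gt0 ?pi_gt0//= gtr_pMr ?pi_gt0.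
by rewrite mulr_gt0//; apply: H; lra.
Qed.

Lemma bump_gt a t : 0 < a -> a < t < 1 -> 1 / 2 < bump a t.
Proof.
move=> a0 /andP[ta t1]; rewrite bumpE ltrBrDr gtrDl ltr_pdivrMr// mul0r.
rewrite -[a - t]opprB mulrN sinN mulrN oppr_lt0.
have H u : 0 < u < 1 -> 0 < sin (pi * u).
  move=> /andP[u0 u1]; apply: sin_gt0_pi.
  by rewrite mulr_gt0 ?pi_gt0//= gtr_pMr ?pi_gt0.
by rewrite mulr_gt0//; apply: H; lra.
Qed.

Lemma trigonometric_bump a : trigonometric (fun t => (bump a t)%:C%C : C).
Proof.
pose z : C := cis (pi * a).
have T1 := trigonometricZ (- (1 / 8) * z^*) (trigonometric_trig R 1).
have T2 := trigonometricZ (- (1 / 8) * z) (trigonometric_trig R (-1)).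
have T3 := trigonometric_cst (1 / 2 + cos (pi * a) / 4)%:C%C.
have [n [c cE]] := trigonometricD T3 (trigonometricD T1 T2).
exists n, c => t; rewrite -cE.
have -> : - (1 / 8) = (- (1 / 8 : R))%:C%C :> C.
  by rewrite rmorphN rmorphM fmorphV rmorph1 rmorph_nat.
rewrite /trig /bump /z; set y := pi * a.
have -> : 2 * pi * (-1)%:~R * t = - (2 * pi * t) by rewrite mulrN1z; ring.
have -> : 2 * pi * 1%:~R * t = 2 * pi * t by rewrite mulr1z; ring.
rewrite cosB; apply: complex_ext.
  by rewrite !(cReD, cReM, cImM, cReJ, cImJ) /= cosN sinN; field.
by rewrite !(cImD, cReM, cImM, cReJ, cImJ) /= cosN sinN; ring.
Qed.

(** The step polynomials evaluated at [bump a] converge to the indicator of the arc, except perhaps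
    at 0 and a, where [bump a] is 1/2; these two points form a null set. *)
Lemma dense_arc (a : R) : 0 < a < 1 ->
  trig_dense (charfun (`[0, a[%classic : set (lebesgueType R))).
Proof.
move=> /andP[a0 a1].
pose p (n : nat) (t : R) : R := (1 - bump a t ^+ n) ^+ (2 ^ n).
have mA : measurable (`[0, a[%classic : set (lebesgueType R)).
  by apply: borel_lebesgue; exact: measurable_itv.
apply: (@dense_dominated _ (fun n t => (p n t)%:C%C) _ (fun=> 1)).
- move=> n; apply: dense_trigonometric.
  have T1 := trigonometricX n (trigonometric_bump a).
  have T2 := trigonometricD (trigonometric_cst 1) (trigonometricZ (-1) T1).
  have [m [c cE]] := trigonometricX (2 ^ n) T2.
  exists m, c => t; rewrite -cE /p rmorphXn rmorphB rmorph1 rmorphXn.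
  by rewrite mulN1r.
- exact: L2_charfun.
- exact: integrable_torus_cst.
- move=> n t _; rewrite /nsq /charfun -rmorphB /= expr0n addr0.
  have /andP[b0 b1] := bump01 a t.
  have bn0 : 0 <= bump a t ^+ n by rewrite exprn_ge0.
  have bn1 : bump a t ^+ n <= 1 by rewrite exprn_ile1.
  have p0 : 0 <= p n t by rewrite exprn_ge0// subr_ge0.
  have p1 : p n t <= 1 by apply: exprn_ile1; rewrite ?subr_ge0//; lra.
  rewrite indicE; case: (_ \in _) => /=.
    by rewrite expr_le1// ?subr_ge0//; lra.
  by rewrite sub0r sqrrN expr_le1.
have H t : D t -> t != 0 -> t != a ->
    nsq (charfun (`[0, a[%classic : set (lebesgueType R)) t - (p n t)%:C%C) @[n --> \oo] --> (0:R).
  rewrite /torus /= in_itv /= => /andP[t0 t1] tn0 tna.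
  have E (b : R) : p ^~ t @ \oo --> b -> nsq (b%:C%C - (p n t)%:C%C) @[n --> \oo] --> (0:R).
    move=> cb; have -> : (fun n => nsq (b%:C%C - (p n t)%:C%C)) = (fun n => (b - p n t) * (b - p n t)).
      by apply/funext => n; rewrite /nsq -rmorphB /= expr0n addr0 expr2.
    have cB : b - p n t @[n --> \oo] --> (0 : R).
      by rewrite -(subrr b); apply: cvgB => //; exact: cvg_cst.
    by have := cvgM cB cB; rewrite mulr0; apply.
  apply: E; rewrite indicE; case: (ltgtP t a) tna => // ta _.
    rewrite mem_set; last by rewrite /= in_itv /= t0.
    apply: step_poly_lt; have /andP[-> _] := bump01 a t.
    by apply: bump_lt => //; rewrite ta lt_neqAle eq_sym tn0 t0.
  rewrite memNset; last by rewrite /= in_itv /= t0 ltNge (ltW ta).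
  apply: step_poly_gt; have /andP[_ ->] := bump01 a t.
  by rewrite andbT; apply: bump_gt => //; rewrite ta t1.
have m1 (x : R) : measurable ([set x] : set (lebesgueType R)).
  exact: (@borel_lebesgue _ [set x] (measurable_set1 x)).
exists ([set 0] `|` [set a]); split.
- exact: measurableU.
- by apply: null_set_setU => //; exact: leb_set1.
move=> t /= nH; apply: contrapT => /not_orP[/eqP t0 /eqP ta]; apply: nH => Dt.
exact: H.
Qed.

Lemma dense_ray (x : R) :
  trig_dense (charfun (`]-oo, x[%classic : set (lebesgueType R))).
Proof.
have mc : cmeas D (charfun (`]-oo, x[%classic : set (lebesgueType R))).
  by apply: cmeas_charfun; apply: borel_lebesgue; exact: measurable_itv.
have eqD f : trig_dense f ->
    (forall t, D t -> f t = charfun (`]-oo, x[%classic : set (lebesgueType R)) t) ->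
    trig_dense (charfun (`]-oo, x[%classic : set (lebesgueType R))).
  by move=> df fE; apply: (dense_ae df mc); exact: aeW.
have DE t : D t -> 0 <= t < 1 by rewrite /torus /= in_itv.
have [x0|x0] := leP x 0.
  apply: (eqD (fun=> 0)); first exact/dense_trigonometric/trigonometric_cst.
  move=> t /DE/andP[t0 _]; rewrite /charfun indicE memNset//= in_itv /=.
  by apply/negP; rewrite -leNgt (le_trans x0).
have [x1|x1] := leP 1 x.
  apply: (eqD (fun=> 1)); first exact/dense_trigonometric/trigonometric_cst.
  move=> t /DE/andP[_ t1]; rewrite /charfun indicE mem_set//= in_itv /=.
  exact: lt_le_trans x1.
apply: (eqD (charfun (`[0, x[%classic : set (lebesgueType R)))).
  by apply: dense_arc; rewrite x0 x1.
move=> t /DE/andP[t0 _]; rewrite /charfun !indicE; congr ((_ : bool)%:R%:C)%C.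
by apply/idP/idP; rewrite !inE /= !in_itv /= t0.
Qed.

Lemma dense_setD (A B : set (lebesgueType R)) : B `<=` A ->
  trig_dense (charfun A) -> trig_dense (charfun B) -> trig_dense (charfun (A `\` B)).
Proof.
move=> BA dA dB; have := denseB dA dB.
have -> // : (fun t => charfun A t - charfun B t) = charfun (A `\` B).
apply/funext => t; rewrite /charfun -rmorphB /= !indicE; congr (_%:C)%C.
rewrite in_setD; have [tB|tB] := boolP (t \in B); last by rewrite subr0 andbT.
by rewrite andbF (_ : t \in A) ?subrr// inE; apply: BA; rewrite inE in tB.
Qed.

Lemma dense_bigcup (F : nat -> set (lebesgueType R)) : nondecreasing_seq F ->
  (forall n, measurable (F n)) -> (forall n, trig_dense (charfun (F n))) ->
  trig_dense (charfun (\bigcup_n F n)).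
Proof.
move=> ndF mF dF.
apply: (@dense_dominated _ (fun n => charfun (F n)) _ (fun=> 1)).
- exact: dF.
- by apply: L2_charfun; exact: bigcupT_measurable.
- exact: integrable_torus_cst.
- move=> n t _; rewrite /charfun -rmorphB /= /nsq /= expr0n addr0 !indicE.
  by case: (_ \in _); case: (_ \in _) => /=; rewrite ?subrr ?subr0 ?sub0r ?sqrrN ?expr1n ?expr0n ?ler01.
apply: aeW => t _; have [Ut|Ut] := pselect ((\bigcup_n F n) t).
  have [N _ FN] := Ut.
  apply: cvg_near_cst; exists N => // n /= Nn; rewrite /charfun !indicE.
  rewrite !mem_set//; first by rewrite subrr /nsq /= expr0n addr0.
  by have /subsetPset := ndF _ _ Nn; apply.
apply: cvg_near_cst; apply: nearW => n; rewrite /charfun !indicE !memNset//.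
  by rewrite subrr /nsq /= expr0n addr0.
by move=> Ft; apply: Ut; exists n.
Qed.

(** Dynkin's theorem: the rays generate the Borel sets and are stable under intersection, while
    approximability of the indicator passes to proper differences by linearity and to increasing
    unions by dominated convergence. *)
Lemma dense_borel (B : set (measurableTypeR R)) : measurable B ->
  trig_dense (charfun (B : set (lebesgueType R))).
Proof.
pose H : set (set R) := [set A | measurable (A : set (measurableTypeR R)) /\
  trig_dense (charfun (A : set (lebesgueType R)))].
suff : <<s @RGenInftyO.G R >> `<=` H.
  by move=> GH; rewrite RGenInftyO.measurableE => /GH[].
apply: lambda_system_subset.
- move=> _ _ [x ->] [y ->]; exists (Num.min x y); apply/seteqP; split=> t /=.
    by rewrite !in_itv /= lt_min => -[-> ->].
  by rewrite !in_itv /= lt_min => /andP[].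
- split.
  + by [].
  + split; first exact: measurableT.
    rewrite (_ : charfun setT = fun=> 1).
      exact/dense_trigonometric/trigonometric_cst.
    by apply/funext => t; rewrite /charfun indicT.
  + move=> A1 B1 BA [mA dA] [mB dB]; split; first exact: measurableD.
    exact: dense_setD.
  + move=> F ndF HF; split; first by apply: bigcupT_measurable => n; exact: (HF n).1.
    apply: (dense_bigcup ndF) => n; last exact: (HF n).2.
    by apply: borel_lebesgue; exact: (HF n).1.
- by move=> _ [x ->]; split; [exact: measurable_itv|exact: dense_ray].
- by [].
Qed.

(** A Lebesgue set differs from a Borel set by a subset of a Borel null set. *)
Lemma dense_measurable (B : set (lebesgueType R)) : measurable B ->
  trig_dense (charfun B).
Proof.
move=> mB; have := mB.
rewrite -[measurable B]/((_.-cara.-measurable) B) -completed_caratheodory_measurable.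
rewrite g_sigma_completed_algebra_genE => -[/= X mX [N [M [mM M0 NM]]] BE].
apply: (dense_ae (dense_borel mX)); first exact: cmeas_charfun.
exists M; split; [exact: borel_lebesgue|by rewrite leb_borel|].
move=> t /= H; apply: contrapT => Mt; apply: H => _.
rewrite /charfun !indicE; congr ((_ : bool)%:R%:C)%C.
apply/idP/idP; rewrite !inE -BE; first by left.
by case=> // /NM.
Qed.

Lemma dense_nonneg (u : lebesgueType R -> R) : measurable_fun D u ->
  (forall t, D t -> 0 <= u t) -> L2 (fun t => (u t)%:C%C) ->
  trig_dense (fun t => (u t)%:C%C).
Proof.
move=> mu' u0 [mcu u2].
have mEu : measurable_fun D (EFin \o u) by exact/measurable_EFinP.
have u0E t : D t -> (0 <= (EFin \o u) t)%E by move=> Dt; rewrite lee_fin u0.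
pose F n := nnsfun_approx mD mEu n.
have cvF t : D t -> F n t @[n --> \oo] --> u t.
  move=> Dt; have := cvg_nnsfun_approx mD mEu u0E Dt.
  by move/fine_cvgP => [_].
have Fle n t : D t -> F n t <= u t.
  move=> Dt.
  have -> : u t = limn ((F : nat -> lebesgueType R -> R) ^~ t).
    by apply/esym/cvg_lim; [exact: Rhausdorff|exact: cvF].
  apply: (@nondecreasing_cvgn_le _ ((F : nat -> lebesgueType R -> R) ^~ t)).
    by move=> a b ab; have /lefP := nd_nnsfun_approx mD mEu ab; apply.
  by apply/cvg_ex; exists (u t); exact: cvF.
apply: (@dense_dominated _ (fun n t => (F n t)%:C%C) _ (fun t => nsq (u t)%:C%C)).
- move=> n; pose s := fset_set (range (F n)).
  have -> : (fun t => (F n t)%:C%C) =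
     (fun t => \sum_(y <- s) (y%:C%C * charfun (F n @^-1` [set y]) t)) :> (_ -> C).
    apply/funext => t; rewrite fimfunE fsbig_finite// rmorph_sum.
    by apply: eq_bigr => y _; rewrite rmorphM.
  elim: (s : seq R) => [|y r IH].
    under eq_fun do rewrite big_nil.
    exact/dense_trigonometric/trigonometric_cst.
  under eq_fun do rewrite big_cons.
  by apply: denseD IH; apply: denseZ; exact: dense_measurable.
- by split.
- exact: u2.
- move=> n t Dt; rewrite -rmorphB /nsq /= expr0n !addr0.
  have Fu := Fle n t Dt; have F0 : 0 <= F n t by [].
  by rewrite ler_sqr ?nnegrE ?subr_ge0// ?gerBl//; exact: u0.
apply: aeW => t Dt.
have cB : u t - F n t @[n --> \oo] --> (0 : R).
  by rewrite -(subrr (u t)); apply: cvgB; [exact: cvg_cst|exact: cvF].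
have -> : (fun n => nsq ((u t)%:C%C - (F n t)%:C%C)) =
          (fun n => (u t - F n t) * (u t - F n t)).
  by apply/funext => n; rewrite /nsq -rmorphB /= expr0n addr0 expr2.
by have := cvgM cB cB; rewrite mulr0; apply.
Qed.

Lemma dense_real (u : lebesgueType R -> R) : measurable_fun D u ->
  L2 (fun t => (u t)%:C%C) -> trig_dense (fun t => (u t)%:C%C).
Proof.
move=> mu' Lu.
have pos (v : lebesgueType R -> R) : measurable_fun D v ->
    (forall t, D t -> nsq ((Num.max (v t) 0)%:C%C) <= nsq ((u t)%:C%C)) ->
    trig_dense (fun t => (Num.max (v t) 0)%:C%C).
  move=> mv vu.
  have mv0 : measurable_fun D (fun t => Num.max (v t) 0).
    by apply: measurable_maxr => //; exact: measurable_cst.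
  apply: dense_nonneg => //; first by move=> t _; rewrite le_max lexx orbT.
  by apply: (L2_dominated mD _ Lu.2 vu); exact: cmeas_real.
have nsqR (x : R) : nsq x%:C%C = x ^+ 2 by rewrite /nsq /= expr0n addr0.
have d1 : trig_dense (fun t => (Num.max (u t) 0)%:C%C).
  apply: pos => // t _; rewrite !nsqR; case: (leP (u t) 0) => // ?.
  by rewrite expr0n sqr_ge0.
have d2 : trig_dense (fun t => (Num.max (- u t) 0)%:C%C).
  apply: pos; first exact: measurable_funN.
  move=> t _; rewrite !nsqR; case: (leP (- u t) 0) => // ?; last by rewrite sqrrN.
  by rewrite expr0n sqr_ge0.
have := denseB d1 d2; congr trig_dense; apply/funext => t.
rewrite -rmorphB; congr (_%:C)%C.
by case: (leP (u t) 0); case: (leP (- u t) 0); lra.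
Qed.

Lemma dense_L2 (f : lebesgueType R -> C) : L2 f -> trig_dense f.
Proof.
move=> Lf; have [[m1 m2] f2] := Lf.
have nsqR (x : R) : nsq x%:C%C = x ^+ 2 by rewrite /nsq /= expr0n addr0.
have d1 : trig_dense (fun t => (complex.Re (f t))%:C%C).
  apply: dense_real => //; apply: (L2_dominated mD (cmeas_real m1) f2) => t _.
  by rewrite nsqR lerDl sqr_ge0.
have d2 : trig_dense (fun t => (complex.Im (f t))%:C%C).
  apply: dense_real => //; apply: (L2_dominated mD (cmeas_real m2) f2) => t _.
  by rewrite nsqR lerDr sqr_ge0.
have := denseD d1 (denseZ 'i%C d2); congr trig_dense; apply/funext => t.
by rewrite -complexE.
Qed.

End DensityAll.

(** * Uniqueness *)

Section Uniqueness.
Variable R : realType.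
Local Notation C := R[i].
Local Notation mu := (@leb R).
Local Notation D := (@torus R).
Local Notation L2 := (L2 mu D).
Local Notation ip := (ip mu D).
Local Notation nrm := (nrm mu D).
Let mD : measurable D := @measurable_torus R.

Lemma nsqN (z : C) : nsq (- z) = nsq z.
Proof. by rewrite /nsq cReN cImN !sqrrN. Qed.

Lemma le_eps0 (x K : R) : 0 <= x -> 0 <= K ->
  (forall eps, 0 < eps -> x <= eps * K) -> x = 0.
Proof.
move=> x0 K0 H; apply/eqP; rewrite eq_le x0 andbT leNgt; apply/negP => xp.
have K1 : 0 < K + 1 by rewrite ltr_wpDl.
have := H (x / (K + 1) / 2); rewrite !divr_gt0// => /(_ isT).
rewrite leNgt => /negP; apply.
rewrite mulrAC ltr_pdivrMr// mulrAC ltr_pdivrMr//.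
rewrite -mulrA ltr_pM2l//; lra.
Qed.

Lemma ip_cutC (A : set (lebesgueType R)) f h : ip f (cut_by A h) = ip (cut_by A f) h.
Proof.
congr cintegral; apply/funext => t; rewrite /cut_by rmorphM /= mulrCA mulrA.
congr (_ * _ * _); apply: complex_ext; rewrite ?cReJ ?cImJ //=; exact: oppr0.
Qed.

(* Let c be the vector of config_minimizer and g the cut-off to A of the
   trigonometric polynomial with coefficients c. Then f is orthogonal to g, while
   on the window [f^ conj g^] is supported at k only; hence f^(k) is minus
   the inner product of f with the part r of g of frequencies off the window, and
   r only sees f up to a trigonometric polynomial p close to f. *)
Lemma fourier_vanish (A : set (lebesgueType R)) (S : powZ) (k : int) (K : R)
    (f : lebesgueType R -> C) :
  measurable A -> L2 f -> {ae mu, forall t, A t -> f t = 0} ->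
  (forall n : int, ~~ S n -> fourier f n = 0) -> 0 <= K ->
  (forall m, exists2 n, (m <= n)%N & exists i : 'I_n, let E := trace (@seg n) S in
     [/\ seg i = k, i \in E,
         \det (config_mx (sub_mx (toeplitz A) (@seg n)) E) != 0 &
         \det (config_mx (sub_mx (toeplitz A) (@seg n)) (E :\ i)) <=
         K%:C%C * \det (config_mx (sub_mx (toeplitz A) (@seg n)) E)]) ->
  fourier f k = 0.
Proof.
move=> mA Lf fA fS K0 HK; apply/eqP; rewrite -nsq_eq0; apply/eqP.
apply: (le_eps0 (nsq_ge0 _) K0) => eps eps0.
have [_ /(_ _ eps0)[p [m [b pE]] fp]] := dense_L2 Lf.
have Lp : L2 p by apply: L2_trigonometric; exists m, b.
(* The number m of terms of p is passed to the hypothesis, so that the window contains all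
   frequencies of p and r is orthogonal to p. *)
have [n mn [i /= [ik iE dE0 dK]]] := HK m; set E := trace _ _ in iE dE0 dK.
have [c [Qc cE]] := config_minimizer iE dE0.
have dE : 0 < \det (config_mx (sub_mx (toeplitz A) (@seg n)) E).
  rewrite lt_neqAle eq_sym dE0 config_ge0//.
  - by move=> ? ?; exact: toeplitz_herm.
  - by move=> ? ? ? ?; exact: energy_ge0.
  - exact: seg_inj.
pose e (j : 'I_n) := trig (R:=R) (seg j).
have Le j : L2 (e j) by exact: L2_trig.
have oe j l : ip (e j) (e l) = (j == l)%:R.
  by rewrite ip_trig (inj_eq (@seg_inj n)).
pose g := cut_by A (trig_poly (@seg n) c).
have Lg : L2 g by exact: (L2_cut mA (L2_trig_poly (@seg n) c)).
pose r := residual mu D e g.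
have Lr : L2 r by exact: (L2_residual mD Le Lg).
(* The squared norm of r is the energy of c, that is, the ratio of the two determinants. *)
have rK : nrm r <= K.
  rewrite -lecR; have := energy_residual mA c (@seg_inj n).
  rewrite -[residual _ _ _ _]/r => <-.
  by rewrite -(ler_pM2r dE) cE.
have pcomb : p = comb e (fun j => if (j < m)%N then b j else 0).
  by apply/funext => t; rewrite pE (trigsum_widen b t mn).
have fg0 : ip f g = 0.
  rewrite /g ip_cutC; set h := trig_poly _ _.
  have Lh : L2 h by exact: L2_trig_poly.
  have L00 : L2 (fun=> 0) by exact: L20.
  have mf : cmeas D (cut_by A f) by exact: (cmeasM (cmeas_charfun mA D) Lf.1).
  have cf0 : {ae mu, forall t, D t -> cut_by A f t = 0}.
    apply: filterS fA => t fA _; rewrite /cut_by /charfun indicE.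
    have [tA|tA] := boolP (t \in A); last by rewrite mul0r.
    by rewrite fA ?mulr0//; rewrite inE in tA.
  rewrite (ip_ae_eq mD mf (cmeas_cst D 0) Lh.1 cf0).
  rewrite -[RHS](mul0r (ip (fun=> 0) h)) -(ipZl mD 0 L00 Lh).
  by congr cintegral; apply/funext => t; rewrite !mul0r.
have fr : ip f r = ip (fun t => f t - p t) r.
  rewrite (ipBl mD Lf Lp Lr) (ipC mD Lr Lp) pcomb.
  by rewrite (residual_orth_comb mD Le oe _ Lg) conjC0 subr0.
have fgE : ip f g = ip f r + fourier f k.
  have Lc : L2 (comb e (fun j => ip g (e j))) by exact: (L2_comb mD Le).
  rewrite (ipBr mD Lg Lc Lf) -addrA -[LHS]addr0; congr (_ + _); apply/esym.
  apply/eqP; rewrite addrC subr_eq0; apply/eqP.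
  have LF j : L2 (fun t => ip g (e j) * e j t) by exact: (L2Z mD _ (Le j)).
  rewrite (ip_sumr mD _ LF Lf) (bigD1 i)//= big1 ?addr0.
    by rewrite (ipZr mD _ (Le i) Lf) /g ip_cut_trig_poly// conjCK Qc// eqxx mul1r -fourierE ik.
  move=> j ji; rewrite (ipZr mD _ (Le j) Lf) /g ip_cut_trig_poly// conjCK.
  have [jE|jE] := boolP (j \in E); first by rewrite Qc// (negbTE ji) mul0r.
  by rewrite -fourierE fS ?mulr0//; move: jE; rewrite inE.
have -> : fourier f k = - ip (fun t => f t - p t) r.
  by rewrite -fr; apply/eqP; rewrite -addr_eq0 addrC -fgE fg0.
rewrite nsqN; apply: (le_trans (cauchy_schwarz mD (L2B mD Lf Lp) Lr)).
by apply: ler_pM; rewrite ?nrm_ge0// ltW.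
Qed.

(** Since f is orthogonal to any trigonometric p, its squared norm is the inner product of f - p
    with f, and f - p can be made small. *)
Lemma fourier_complete (f : lebesgueType R -> C) : L2 f ->
  (forall n : int, fourier f n = 0) -> {ae mu, forall t, D t -> f t = 0}.
Proof.
move=> Lf f0; apply: (ip_eq0 mD Lf).
rewrite (ip_nrm mu mD) [nrm f](_ : _ = 0)//.
have H : nrm f ^+ 2 = 0.
  apply: (@le_eps0 _ (nrm f)); rewrite ?sqr_ge0 ?nrm_ge0// => eps eps0.
  have [_ /(_ _ eps0)[p [m [b pE]] fp]] := dense_L2 Lf.
  have Lp : L2 p by apply: L2_trigonometric; exists m, b.
  have fp0 : ip f p = 0.
    rewrite (_ : p = fun t => \sum_(i < m) b i * trig (int_enum i) t); last exact/funext.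
    have LF (j : 'I_m) : L2 (fun t => b j * trig (int_enum j) t).
      exact: (L2Z mD _ (L2_trig R _)).
    rewrite (ip_sumr mD _ LF Lf) big1// => i _.
    by rewrite (ipZr mD _ (L2_trig R _) Lf) -fourierE f0 mulr0.
  have E : ip (fun t => f t - p t) f = (nrm f)%:C%C.
    rewrite (ipBl mD Lf Lp Lf) (ip_nrm mu mD) (ipC mD Lf Lp) fp0.
    by rewrite conjC0 subr0.
  have := cauchy_schwarz mD (L2B mD Lf Lp) Lf; rewrite E.
  rewrite {1}/nsq /= expr0n addr0 => /le_trans; apply.
  by rewrite ler_wpM2r ?nrm_ge0// ltW.
by apply/eqP; rewrite -sqrf_eq0 H.
Qed.

End Uniqueness.

(** * Likelihood ratios along the windows *)

Section AlmostSure.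
Variables (R : realType) (A : set (lebesgueType R)) (mA : measurable A).
Variable P : probability borel_powZ R.
Hypothesis dP : determinantal (toeplitz A) P.
Local Notation Q := (toeplitz A).

Definition tprob n (e : 'I_n -> int) (C : {set 'I_n}) : R :=
  fine (P [set S | trace e S = C]).

Lemma tprob_ge0 n (e : 'I_n -> int) C : 0 <= tprob e C.
Proof. by rewrite fine_ge0. Qed.

Lemma tprobE n (e : 'I_n -> int) C : injective e ->
  \det (config_mx (sub_mx Q e) C) = (tprob e C)%:C%C.
Proof. by move=> injE; rewrite -(determinantal_trace C dP injE). Qed.

Lemma sum_tprob n (e : 'I_n -> int) : \sum_(C : {set 'I_n}) tprob e C = 1.
Proof.
rewrite -(prob_trace P e xpredT) (_ : mkset _ = setT) ?probability_setT//.
exact/seteqP.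
Qed.

(** Configurations of probability 0 are counted as having a large ratio, so that off this event the
    configuration matrix is invertible. *)
Definition large_ratio n (e : 'I_n -> int) (i : 'I_n) (K : R) : pred {set 'I_n} :=
  fun C => (i \in C) && ((tprob e C == 0) || (K * tprob e C < tprob e (C :\ i))).

(* Markov's inequality: the likelihood ratio P(C \ i) / P(C), as a function of
   the random C containing i, has expectation at most 1 *)
Lemma prob_large_ratio n (e : 'I_n -> int) (i : 'I_n) (K : R) : 0 < K ->
  (P [set S : borel_powZ | large_ratio e i K (trace e S)] <= K^-1%:E)%E.
Proof.
move=> K0; rewrite -[X in (X <= _)%E]fineK; last first.
  by rewrite fin_num_measure//; exact: measurable_trace.
rewrite lee_fin prob_trace -/(tprob e _).
apply: (@le_trans _ _ (\sum_(C : {set 'I_n} | i \in C) K^-1 * tprob e (C :\ i))).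
  rewrite [leLHS]big_mkcond [leRHS]big_mkcond; apply: ler_sum => C _.
  rewrite /large_ratio; case: (i \in C) => //=; case: ifPn => [|_].
    rewrite -/(tprob e C) ler_pdivlMl// => /predU1P[->|/ltW//].
    by rewrite mulr0 tprob_ge0.
  by rewrite mulr_ge0 ?tprob_ge0// invr_ge0 ltW.
(* The map from C to C \ i is injective on the sets that contain i, so these are probabilities of
   disjoint events. *)
have S1 : \sum_(C : {set 'I_n} | i \in C) tprob e (C :\ i) <= 1.
  rewrite -(sum_tprob e).
  rewrite (reindex_onto (fun C => i |: C) (fun C => C :\ i)) /=; last first.
    by move=> C iC; rewrite finset.setD1K.
  rewrite [leLHS]big_mkcond; apply: ler_sum => C _.
  by case: ifP => [/andP[_ /eqP->]//|_]; exact: tprob_ge0.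
by rewrite -mulr_sumr ler_piMr// invr_ge0 ltW.
Qed.

(** [L j] is the event that the ratio exceeds j + 1 in all but finitely many windows. It is an
    increasing union of events each contained in a single [B j m], so its probability is at most 1 /
    (j + 1), and the intersection over j is null. *)
Lemma ae_bounded_ratio (k : int) :
  {ae P, forall S : borel_powZ, (S : powZ) k -> exists j : nat, forall m,
     exists2 n, (m <= n)%N & exists i : 'I_n,
       let E := trace (@seg n) S in
       [/\ seg i = k, i \in E, tprob (@seg n) E != 0 &
           tprob (@seg n) (E :\ i) <= j.+1%:R * tprob (@seg n) E]}.
Proof.
pose N m := (m + int_rank k).+1.
have kN m : (int_rank k < N m)%N by rewrite ltnS leq_addl.
pose B (j m : nat) : set borel_powZ :=
  [set S | large_ratio (@seg (N m)) (Ordinal (kN m)) j.+1%:R (trace (@seg (N m)) S)].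
have mB j m : measurable (B j m) by exact: measurable_trace.
pose F j m := \bigcap_(l in [set l | (m <= l)%N]) B j l.
have mF j m : measurable (F j m) by apply: bigcap_measurable => [|l _]; [exists m => /=|exact: mB].
pose L j := \bigcup_m F j m.
have mL j : measurable (L j) by exact: bigcupT_measurable.
have PL j : (P (L j) <= j.+1%:R^-1%:E)%E.
  have ndF : nondecreasing_seq (F j).
    move=> a b ab; apply/subsetPset => S FS l /= bl.
    by apply: FS => /=; exact: leq_trans bl.
  have cF := nondecreasing_cvg_mu (mu := P) (mF j) (mL j) ndF.
  rewrite -(cvg_lim _ cF)//; apply: lime_le.
    by apply/cvg_ex; exists (P (L j)).
  apply: nearW => m /=.
  apply: le_trans (prob_large_ratio (@seg (N m)) (Ordinal (kN m)) _ (K:=j.+1%:R)) => //.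
  by apply: le_measure; rewrite ?inE//; [exact: mB|move=> S; apply => /=].
exists (\bigcap_j L j); split; first exact: bigcapT_measurable.
  apply/eqP; rewrite eq_le measure_ge0 andbT; apply/lee_addgt0Pr => eps eps0.
  have [j je] : exists j : nat, j.+1%:R^-1 < eps.
    by have [j] := ltr_add_invr eps0; rewrite add0r => ?; exists j.
  have le1 : (P (\bigcap_j L j) <= P (L j))%E.
    apply: le_measure; rewrite ?inE; [exact: bigcapT_measurable|exact: mL|].
    by move=> S; apply.
  by rewrite add0e (le_trans le1)// (le_trans (PL j))// lee_fin ltW.
move=> S /= HS j _; apply: contrapT => nL; apply: HS => Sk; exists j => m.
have : ~ F j m S by move=> FS; apply: nL; exists m.
move=> /existsNP[l /not_implyP[/= ml /negP nB]].
exists (N l); first by rewrite /N; lia.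
exists (Ordinal (kN l)) => /=.
have segk : seg (Ordinal (kN l)) = k by rewrite /seg /= int_rankK.
have iE : Ordinal (kN l) \in trace (@seg (N l)) S by rewrite inE segk.
by move: nB; rewrite /B /= /large_ratio iE /= negb_or -leNgt => /andP[-> ->].
Qed.

(** The null sets of the countably many k are united before f is chosen. The coefficients on S then
    vanish by [fourier_vanish], those off S by assumption. *)
Lemma ae_uniqueness : {ae P, forall S, uniqueness_set A S}.
Proof.
have H : {ae P, forall S n, (S : powZ) (int_enum n) -> exists j : nat, forall m,
     exists2 n', (m <= n')%N & exists i : 'I_n',
       let E := trace (@seg n') S in
       [/\ seg i = int_enum n, i \in E, tprob (@seg n') E != 0 &
           tprob (@seg n') (E :\ i) <= j.+1%:R * tprob (@seg n') E]}.
  by apply: ae_foralln => n; exact: ae_bounded_ratio.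
apply: (negligibleS _ H) => S /=; apply: contra_not => {}H f /is_L2E Lf fA fS.
apply: fourier_complete => // n.
have [Sn|/fS//] := boolP ((S : powZ) n).
have := H (int_rank n); rewrite int_rankK => /(_ Sn)[j Hj].
apply: (@fourier_vanish _ A S n j.+1%:R) => // m.
have [n' mn' [i /= [H1 H2 H3 H4]]] := Hj m.
exists n' => //; exists i => /=; split => //; rewrite !tprobE//; try exact: seg_inj.
  by rewrite (inj_eq (@complexI R)).
by rewrite -rmorphM lecR.
Qed.

End AlmostSure.

(** * Exponential tails of the counting variables *)

Section Contraction.
Variable C : numClosedFieldType.

(** The form of 1 + s Q at x is (X - q) + (1 + s) q, where 0 <= q <= X: the energy of x is q - Y,
    and X - q - (q - Y) is the squared norm of x - Q x. Both terms cannot vanish, as X > 0. *)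
Lemma posdef_contraction n (Q : 'M[C]_n) (s : C) : hermitian_mx Q ->
  (forall c : 'cV_n, 0 <= energy Q c) -> -1 < s -> posdef (1%:M + s *: Q).
Proof.
move=> hQ EQ s1 x x0.
pose X := \sum_i (x i 0)^* * x i 0.
pose q := \sum_i (x i 0)^* * (Q *m x) i 0.
pose Y := \sum_i ((Q *m x) i 0)^* * (Q *m x) i 0.
have sqr_sum (y : 'cV[C]_n) : 0 <= \sum_i (y i 0)^* * y i 0.
  by apply: sumr_ge0 => i _; rewrite mulrC mul_conjC_ge0.
have subE (u v : 'cV[C]_n) i : (u - v) i 0 = u i 0 - v i 0 by rewrite !mxE.
have Yq : Y <= q.
  rewrite -subr_ge0; have := EQ x; congr (0 <= _).
  rewrite /q -(hermitian_dot _ hQ) -sumrB; apply: eq_bigr => i _.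
  by rewrite mulmxBl mul1mx subE mulrBr.
have qX : q <= X.
  have := sqr_sum (x - Q *m x).
  have -> : \sum_i ((x - Q *m x) i 0)^* * (x - Q *m x) i 0 = X - q - (q - Y).
    rewrite {2}/q -(hermitian_dot _ hQ) /X /q /Y -!sumrB; apply: eq_bigr => i _.
    by rewrite subE rmorphB; ring.
  by move=> H; rewrite -subr_ge0; apply: le_trans H _; rewrite gerBl subr_ge0.
have Y0 : 0 <= Y by exact: sqr_sum.
have X0 : 0 < X.
  have [i xi] : exists i, x i 0 != 0.
    apply/existsP; apply: contraR x0; rewrite negb_exists => /forallP H.
    by apply/eqP/matrixP => i j; have := H i; rewrite negbK (ord1 j) mxE => /eqP.
  rewrite /X (bigD1 i)//= ltr_pwDl//; first by rewrite mulrC mul_conjC_gt0.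
  by rewrite sumr_ge0// => j _; rewrite mulrC mul_conjC_ge0.
have -> : \sum_i (x i 0)^* * ((1%:M + s *: Q) *m x) i 0 = X + s * q.
  rewrite /X /q mulr_sumr -big_split /=; apply: eq_bigr => i _.
  by rewrite mulmxDl mul1mx -scalemxAl !mxE; ring.
have q0 : 0 <= q := le_trans Y0 Yq.
have -> : X + s * q = (X - q) + (1 + s) * q by ring.
have s0 : 0 < 1 + s by rewrite -ltrBlDl sub0r.
have [q0'|qN0] := eqVneq q 0; first by rewrite q0' mulr0 subr0 addr0.
by rewrite ltr_wpDl ?subr_ge0// mulr_gt0// lt_neqAle eq_sym qN0.
Qed.

Lemma det_contraction_le n (Q : 'M[C]_n) (s : C) : hermitian_mx Q ->
  (forall c : 'cV_n, 0 <= energy Q c) -> -1 < s ->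
  \det (1%:M + s *: Q) <= \prod_i (1 + s * Q i i).
Proof.
move=> hQ EQ s1.
have cs : s^* = s.
  by apply/CrealP; rewrite -[s](addrK 1) realB ?real1// gtr0_real// addrC -ltrBlDl sub0r.
have /andP[_] : 0 <= \det (1%:M + s *: Q) <= \prod_i (1%:M + s *: Q) i i.
  apply: hadamard_det; last exact: posdef_contraction.
  move=> i j; rewrite !mxE rmorphD (rmorphM _ s) /= cs -hQ eq_sym.
  by rewrite rmorph_nat.
congr (_ <= _); apply: eq_bigr => i _; by rewrite !mxE eqxx.
Qed.

End Contraction.

Section Chernoff.
Variables (R : realType) (A : set (lebesgueType R)) (mA : measurable A).
Hypothesis AT : A `<=` @torus R.
Variable P : probability borel_powZ R.
Hypothesis dP : determinantal (toeplitz A) P.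
Local Notation Q := (toeplitz A).

Definition dens : R := fine (leb R A).

Lemma leb_dens : leb R A = dens%:E.
Proof.
rewrite fineK// ge0_fin_numE//; apply: (@le_lt_trans _ _ (leb R (@torus R))).
  by apply: le_measure; rewrite ?inE//; exact: measurable_torus.
by rewrite leb_torus ltry.
Qed.

Lemma dens_ge0 : 0 <= dens.
Proof. by rewrite fine_ge0. Qed.

Lemma dens_le1 : dens <= 1.
Proof.
rewrite -lee_fin -leb_dens -(leb_torus R); apply: le_measure; rewrite ?inE//.
exact: measurable_torus.
Qed.

Lemma toeplitz_diag k : Q k k = dens%:C%C.
Proof.
rewrite toeplitzE; apply: complex_ext => /=.
  have E t : complex.Re (cut_by A (trig k) t * (trig k t)^*) = \1_A t.
    by rewrite /cut_by -mulrA -nsqE nsq_cis mulr1.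
  transitivity (\int[leb R]_(t in @torus R) (\1_A t : R)).
    by apply: eq_Rintegral => t _; exact: E.
  rewrite /Rintegral integral_indic//; last exact: measurable_torus.
  by rewrite setIidl.
have E t : complex.Im (cut_by A (trig k) t * (trig k t)^*) = 0.
  by rewrite /cut_by -mulrA -nsqE nsq_cis mulr1.
transitivity (\int[leb R]_(t in @torus R) (0 : R)).
  by apply: eq_Rintegral => t _; exact: E.
by rewrite Rintegral_cst ?mul0r//; exact: measurable_torus.
Qed.

Lemma genfun_le n (e : 'I_n -> int) (z : R) : injective e -> 0 < z ->
  \sum_(C : {set 'I_n}) tprob P e C * z ^+ #|C| <= (1 + (z - 1) * dens) ^+ n.
Proof.
move=> injE z0; rewrite -lecR rmorph_sum /=.
have -> : \sum_(C : {set 'I_n}) (tprob P e C * z ^+ #|C|)%:C%C =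
    \det (1%:M + (z%:C%C - 1) *: sub_mx Q e).
  rewrite -sum_config_exp; apply: eq_bigr => C _.
  by rewrite rmorphM rmorphXn (tprobE dP).
apply: (le_trans (det_contraction_le _ _ _)).
- by move=> i j; rewrite !mxE toeplitz_herm.
- by move=> c; exact: energy_ge0.
- by rewrite ltrBrDr addNr -[0]/(0%:C)%C ltcR.
rewrite le_eqVlt; apply/orP; left; apply/eqP.
rewrite rmorphXn -[in RHS](card_ord n) -prodr_const; apply: eq_bigr => i _.
by rewrite mxE toeplitz_diag rmorphD rmorphM rmorphB rmorph1.
Qed.

(** Exponential Markov inequality at z = e^lam, followed by 1 + x <= e^x. The factor lam on both
    sides of the event leaves its sign free: positive lam gives the upper tail, negative lam the
    lower one. *)
Lemma chernoff n (e : 'I_n -> int) (lam D : R) : injective e ->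
  (P [set S : borel_powZ | (lam * (D * n%:R) <= lam * #|trace e S|%:R)%R]
   <= (expR (- (n%:R * (lam * D - (expR lam - 1) * dens))))%:E)%E.
Proof.
move=> injE.
pose G : pred {set 'I_n} := fun C => lam * (D * n%:R) <= lam * #|C|%:R.
have mG : measurable [set S : borel_powZ | G (trace e S)] by exact: measurable_trace.
rewrite -[X in (X <= _)%E]fineK; last by rewrite fin_num_measure.
rewrite lee_fin (prob_trace P e G).
have -> : expR (- (n%:R * (lam * D - (expR lam - 1) * dens))) =
   expR (- (lam * (D * n%:R))) * expR ((expR lam - 1) * dens) ^+ n.
  by rewrite -expRM_natl -expRD; congr expR; ring.
apply: (@le_trans _ _ (expR (- (lam * (D * n%:R))) *
   \sum_(C : {set 'I_n}) tprob P e C * expR lam ^+ #|C|)); last first.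
  rewrite ler_wpM2l ?expR_ge0//.
  apply: le_trans (genfun_le injE (expR_gt0 lam)) _.
  rewrite lerXn2r ?nnegrE ?expR_ge0//; last exact: expR_ge1Dx.
  have := dens_le1; have := mulr_ge0 (expR_ge0 lam) dens_ge0; lra.
rewrite mulr_sumr [leLHS]big_mkcond; apply: ler_sum => C _.
case: ifPn => [GC|_]; last by rewrite !mulr_ge0 ?tprob_ge0 ?expR_ge0 ?exprn_ge0 ?expR_ge0.
rewrite mulrCA -[leLHS]mulr1 ler_wpM2l ?tprob_ge0//.
rewrite -expRM_natl -expRD -[leLHS]expR0 ler_expR addrC subr_ge0.
by rewrite [_%:R * lam]mulrC.
Qed.

Lemma tail_upper (D : R) : dens < D -> exists2 delta : R, 0 < delta &
  forall n (e : 'I_n -> int), injective e ->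
  (P [set S : borel_powZ | (D * n%:R <= #|trace e S|%:R)%R]
   <= (expR (- (delta * n%:R)))%:E)%E.
Proof.
move=> aD; have D0 : 0 < D := le_lt_trans dens_ge0 aD.
(* With e^lam <= 1 / (1 - lam), the rate times 1 - lam is at least lam (D - dens - lam D); this
   choice makes lam D half of D - dens. *)
pose lam := (D - dens) / (2 * D).
have lam0 : 0 < lam by rewrite divr_gt0 ?subr_gt0// mulr_gt0.
have lamE : 2 * (lam * D) = D - dens by rewrite /lam; field; rewrite gt_eqF.
have lam1 : lam < 1.
  by rewrite ltr_pdivrMr ?mulr_gt0// mul1r; have := dens_ge0; lra.
exists (lam * D - (expR lam - 1) * dens); last first.
  move=> n e injE; have := chernoff lam D injE.
  rewrite (_ : [set S | _] = [set S : borel_powZ | (D * n%:R <= #|trace e S|%:R)%R]).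
    by rewrite [(_ - _) * n%:R]mulrC.
  by apply/seteqP; split=> S /=; rewrite ler_pM2l.
have H : expR lam * (1 - lam) <= 1.
  rewrite -[leRHS](expRxMexpNx_1 lam) ler_pM2l ?expR_gt0//.
  exact: (expR_ge1Dx (- lam)).
have l1 : 0 < 1 - lam by rewrite subr_gt0.
rewrite -(pmulr_lgt0 _ l1).
have -> : (lam * D - (expR lam - 1) * dens) * (1 - lam) =
  lam * (D - lam * D - dens) + dens * (1 - expR lam * (1 - lam)) by ring.
rewrite ltr_pwDl ?mulr_ge0 ?dens_ge0 ?subr_ge0// mulr_gt0//; lra.
Qed.

Lemma tail_lower (D : R) : 0 <= D -> D < dens -> exists2 delta : R, 0 < delta &
  forall n (e : 'I_n -> int), injective e ->
  (P [set S : borel_powZ | (#|trace e S|%:R <= D * n%:R)%R]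
   <= (expR (- (delta * n%:R)))%:E)%E.
Proof.
move=> D0 Da; have a0 : 0 < dens := le_lt_trans D0 Da.
(* With e^(-lam) <= 1 / (1 + lam), the rate times 1 + lam is at least lam (dens - D - lam D), and
   lam D is at most lam dens, half of dens - D. *)
pose lam := (dens - D) / (2 * dens).
have lam0 : 0 < lam by rewrite divr_gt0 ?subr_gt0// mulr_gt0.
have lamE : 2 * (lam * dens) = dens - D by rewrite /lam; field; rewrite gt_eqF.
exists (- lam * D - (expR (- lam) - 1) * dens); last first.
  move=> n e injE; have := chernoff (- lam) D injE.
  rewrite (_ : [set S | _] = [set S : borel_powZ | (#|trace e S|%:R <= D * n%:R)%R]).
    by rewrite [(_ - _) * n%:R]mulrC.
  by apply/seteqP; split=> S /=; rewrite !mulNr lerN2 ler_pM2l.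
have H : (1 + lam) * expR (- lam) <= 1.
  rewrite -[leRHS](expRxMexpNx_1 lam) ler_pM2r ?expR_gt0//.
  exact: expR_ge1Dx.
have l1 : 0 < 1 + lam by rewrite addr_gt0.
rewrite -(pmulr_lgt0 _ l1).
have -> : (- lam * D - (expR (- lam) - 1) * dens) * (1 + lam) =
  lam * (dens - D - lam * D) + dens * (1 - (1 + lam) * expR (- lam)) by ring.
rewrite ltr_pwDl ?mulr_ge0 ?dens_ge0 ?subr_ge0// mulr_gt0//.
have : lam * D <= lam * dens by rewrite ler_pM2l// ltW.
lra.
Qed.

(** The fourth power of e^(y / 4) >= y / 4. *)
Lemma expRN_le (y : R) : 0 < y -> expR (- y) <= (4 / y) ^+ 4.
Proof.
move=> y0; rewrite expRN -[4 / y]invf_div exprVn lef_pV2 ?posrE ?expR_gt0//; last first.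
  by rewrite exprn_gt0// divr_gt0.
have -> : expR y = expR (y / 4) ^+ 4 by rewrite -expRM_natl; congr expR; field.
rewrite lerXn2r ?nnegrE ?expR_ge0//; first by rewrite divr_ge0// ltW.
by apply: le_trans (expR_ge1Dx _); rewrite lerDr.
Qed.

End Chernoff.

(** * The upper bound for the density *)

Section Intervals.
Variable R : realType.

Definition iv (a : int) l (i : 'I_l) : int := a + (i : nat)%:Z.

Lemma iv_inj a l : injective (@iv a l).
Proof. by move=> i j /addrI [] /val_inj. Qed.

Lemma zitvE (a : int) l (k : int) :
  zitv (a, a + l%:Z) k <-> exists i : 'I_l.+1, k = iv a i.
Proof.
rewrite /zitv /iv /=; split=> [/andP[ak kl]|[i ->]].
  have kL : (`|k - a| < l.+1)%N by lia.
  by exists (Ordinal kL) => /=; lia.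
by have := ltn_ord i; lia.
Qed.

Lemma card_trace_zitv (S : powZ) (a : int) l :
  #|` fset_set ([set k | S k] `&` zitv (a, a + l%:Z))| = #|trace (@iv a l.+1) S|.
Proof.
have -> : [set k | S k] `&` zitv (a, a + l%:Z) =
    [set` [fset iv a i | i in trace (@iv a l.+1) S]%fset].
  apply/seteqP; split=> k /=.
    by move=> [Sk /zitvE[i kE]]; apply/imfsetP; exists i => //=; rewrite inE -kE.
  by move=> /imfsetP[i /= iS ->]; split; [rewrite inE in iS|apply/zitvE; exists i].
rewrite set_fsetK card_imfset; last exact: iv_inj.
by rewrite cardE.
Qed.

Lemma card_zitv (a : int) l : #|` fset_set (zitv (a, a + l%:Z))| = l.+1.
Proof.
have := card_trace_zitv (fun=> true) a l.
rewrite (_ : [set k | true] = setT) ?setTI => [->|]; last exact/seteqP.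
by rewrite (_ : trace _ _ = [set: 'I_l.+1]%SET) ?cardsT ?card_ord//; apply/setP => i; rewrite !inE.
Qed.

Lemma ler_sum_subseq (T : eqType) (F : T -> R) (s1 s2 : seq T) :
  (forall x, 0 <= F x) -> uniq s1 -> {subset s1 <= s2} ->
  \sum_(x <- s1) F x <= \sum_(x <- s2) F x.
Proof.
move=> F0; elim: s1 s2 => [|x s1 IH] s2 /=; first by rewrite big_nil sumr_ge0.
move=> /andP[xs1 us1] sub; have xs2 : x \in s2 by apply: sub; rewrite mem_head.
rewrite big_cons (big_rem _ xs2) /= lerD2l; apply: IH => // y ys1.
have := sub y; rewrite inE ys1 orbT => /(_ isT).
rewrite (perm_mem (perm_to_rem xs2)) inE => /predU1P[yx|//].
by move: xs1; rewrite -yx ys1.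
Qed.

(** The stronger bound 2 - 1/n for n > 0 terms passes through the induction, because 1/(n + 1)^2 <=
    1/n - 1/(n + 1). *)
Lemma sum_inv_sqr (n : nat) : \sum_(i < n) (i.+1%:R ^+ 2)^-1 <= 2 :> R.
Proof.
case: n => [|n]; first by rewrite big_ord0.
suff : \sum_(i < n.+1) (i.+1%:R ^+ 2)^-1 <= 2 - n.+1%:R^-1 :> R.
  by move/le_trans; apply; rewrite gerBl invr_ge0.
elim: n => [|n IH]; first by rewrite big_ord1 expr1n invr1; lra.
rewrite big_ord_recr /=; apply: (le_trans (lerD IH (lexx _))).
have n0 : 0 < n.+1%:R :> R by rewrite ltr0n.
have -> : n.+2%:R = n.+1%:R + 1 :> R by rewrite -natr1.
move: n0; move: (n.+1%:R : R) => x x0; rewrite -subr_ge0.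
have x1 : 0 < x + 1 by rewrite addr_gt0.
have -> : 2 - (x + 1)^-1 - (2 - x^-1 + ((x + 1) ^+ 2)^-1) =
   (x * (x + 1) ^+ 2)^-1 by field; rewrite !gt_eqF.
by rewrite invr_ge0 mulr_ge0 ?sqr_ge0// ltW.
Qed.

Lemma nneseries_le (f : nat -> R) (B : R) : (forall i, 0 <= f i) ->
  (forall n, \sum_(i < n) f i <= B) -> (\sum_(0 <= i <oo) (f i)%:E <= B%:E)%E.
Proof.
move=> f0 fB; apply: lime_le.
  by apply: is_cvg_nneseries => i _ _; rewrite lee_fin.
by apply: nearW => n; rewrite big_mkord sumEFin lee_fin.
Qed.

End Intervals.

Section Upper.
Variables (R : realType) (A : set (lebesgueType R)) (mA : measurable A).
Hypothesis AT : A `<=` @torus R.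
Variable P : probability borel_powZ R.
Hypothesis dP : determinantal (toeplitz A) P.

(* The interval of l + 1 integers at distance s + 1 from 0, on the positive side
   iff b, starts at start b s l, and weight s l is (aspect - 1)^2. *)
Definition start (b : bool) (s l : nat) : int :=
  if b then s.+1%:Z else - (s.+1 + l)%N%:Z.

Definition weight (s l : nat) : R := (l%:R / s.+1%:R) ^+ 2.

Definition heavy (D : R) b s l : set borel_powZ :=
  [set S | D * l.+1%:R <= #|trace (@iv (start b s l) l.+1) S|%:R].

Definition cost D b s l (S : borel_powZ) : R := weight s l * \1_(heavy D b s l) S.

(** The double sum runs over all intervals on one side of 0, and a heavy one contributes its (aspect
    - 1)^2. *)
Definition total D b (S : borel_powZ) : \bar R :=
  (\sum_(0 <= s <oo) \sum_(0 <= l <oo) (cost D b s l S)%:E)%E.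

Lemma measurable_heavy D b s l : measurable (heavy D b s l).
Proof.
exact: (measurable_trace (@iv (start b s l) l.+1)
  (fun C => D * l.+1%:R <= #|C|%:R)).
Qed.

Lemma cost_ge0 D b s l S : 0 <= cost D b s l S.
Proof. by rewrite mulr_ge0 ?sqr_ge0. Qed.

Lemma measurable_cost D b s l : measurable_fun setT (cost D b s l).
Proof.
apply: measurable_funM; first exact: measurable_cst.
by apply: measurable_indic; exact: measurable_heavy.
Qed.

Lemma measurable_inner D b s :
  measurable_fun setT (fun S => \sum_(0 <= l <oo) (cost D b s l S)%:E)%E.
Proof.
apply: ge0_emeasurable_sum => [l S _ _|l _]; first by rewrite lee_fin cost_ge0.
by apply/measurable_EFinP; exact: measurable_cost.
Qed.

Lemma measurable_total D b : measurable_fun setT (total D b).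
Proof.
apply: ge0_emeasurable_sum => [s S _ _|s _]; last exact: measurable_inner.
by apply: nneseries_ge0 => l _ _; rewrite lee_fin cost_ge0.
Qed.

Lemma total_ge0 D b S : (0 <= total D b S)%E.
Proof.
apply: nneseries_ge0 => s _ _; apply: nneseries_ge0 => l _ _.
by rewrite lee_fin cost_ge0.
Qed.

Lemma integral_cost D b s l :
  (\int[P]_S (cost D b s l S)%:E = (weight s l)%:E * P (heavy D b s l))%E.
Proof.
under eq_integral do rewrite /cost EFinM.
have mH := measurable_heavy D b s l.
rewrite ge0_integralZl//.
- by rewrite integral_indic// setIT.
- by apply/measurable_EFinP; exact: measurable_indic.
- by rewrite lee_fin sqr_ge0.
Qed.

Lemma total_lty D b : dens A < D -> {ae P, forall S, (total D b S < +oo)%E}.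
Proof.
move=> aD; have [delta d0 HD] := tail_upper mA AT dP aD.
pose K := (4 / delta) ^+ 4; have K0 : 0 <= K by rewrite exprn_even_ge0.
have sq0 (n : nat) : 0 <= (n.+1%:R ^+ 2)^-1 :> R by rewrite invr_ge0 sqr_ge0.
(* The fourth power of e^(-y) <= (4 / y)^4 leaves room for both sums to converge. *)
have cost_le s l : (\int[P]_S (cost D b s l S)%:E <=
    (K * (s.+1%:R ^+ 2)^-1 * (l.+1%:R ^+ 2)^-1)%:E)%E.
  rewrite integral_cost.
  have w0 : (0 <= (weight s l)%:E)%E by rewrite lee_fin sqr_ge0.
  have H := HD l.+1 _ (@iv_inj (start b s l) l.+1).
  apply: (le_trans (lee_wpmul2l w0 H)).
  rewrite -EFinM lee_fin.
  have l0 : 0 < l.+1%:R :> R by rewrite ltr0n.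
  have s0 : 0 < s.+1%:R :> R by rewrite ltr0n.
  apply: (@le_trans _ _ (weight s l * (4 / (delta * l.+1%:R)) ^+ 4)).
    by rewrite ler_wpM2l ?sqr_ge0// expRN_le// mulr_gt0.
  have -> : weight s l * (4 / (delta * l.+1%:R)) ^+ 4 =
     (K * (s.+1%:R ^+ 2)^-1 * (l.+1%:R ^+ 2)^-1) * (l%:R / l.+1%:R) ^+ 2.
    by rewrite /weight /K; field; rewrite !gt_eqF.
  apply: ler_piMr; first by rewrite !mulr_ge0 ?invr_ge0 ?sqr_ge0 ?exprn_ge0 ?ltW//.
  apply: exprn_ile1; first by rewrite divr_ge0.
  by rewrite ler_pdivrMr// mul1r ler_nat.
have int_total : (\int[P]_S total D b S <= (K * 2 * 2)%:E)%E.
  rewrite integral_nneseries//; last 2 first.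
  - by move=> s; exact: measurable_inner.
  - by move=> s S _; apply: nneseries_ge0 => l _ _; rewrite lee_fin cost_ge0.
  apply: (@le_trans _ _ (\sum_(0 <= s <oo) (K * 2 * (s.+1%:R ^+ 2)^-1)%:E)%E).
    apply: lee_nneseries => [s _ _|s _].
      apply: integral_ge0 => S _; apply: nneseries_ge0 => l _ _.
      by rewrite lee_fin cost_ge0.
    rewrite integral_nneseries//; last 2 first.
    - by move=> l; apply/measurable_EFinP; exact: measurable_cost.
    - by move=> l S _; rewrite lee_fin cost_ge0.
    apply: (@le_trans _ _ (\sum_(0 <= l <oo) (K * (s.+1%:R ^+ 2)^-1 * (l.+1%:R ^+ 2)^-1)%:E)%E).
      apply: lee_nneseries => [l _ _|l _]; last exact: cost_le.
      by apply: integral_ge0 => S _; rewrite lee_fin cost_ge0.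
    apply: nneseries_le => [l|n]; first by apply: mulr_ge0 => //; exact: mulr_ge0.
    rewrite -mulr_sumr -mulrA [2 * _]mulrC mulrA.
    by rewrite ler_wpM2l ?sum_inv_sqr// mulr_ge0.
  apply: nneseries_le => [l|n]; first by apply: mulr_ge0 => //; exact: mulr_ge0.
  by rewrite -mulr_sumr ler_wpM2l ?sum_inv_sqr// mulr_ge0.
have it : P.-integrable setT (total D b).
  apply/integrableP; split; first exact: measurable_total.
  under eq_integral do rewrite gee0_abs ?total_ge0//.
  by apply: le_lt_trans int_total _; rewrite ltry.
have := integrable_ae measurableT it; apply: negligibleS => S /=.
by apply: contra_not => H; rewrite ltey_eq H.
Qed.

(** An interval that avoids 0 lies on one side of it, so that side, distance to 0 and length, the
    last two diminished by 1, determine it. *)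
Definition interval_code (I : int * int) : bool * (nat * nat) :=
  (0 < I.1, ((if (0 < I.1)%R then `|I.1| else `|I.2|)%N.-1, `|I.2 - I.1|%N)).

Definition interval_of (c : bool * (nat * nat)) : int * int :=
  (start c.1 c.2.1 c.2.2, start c.1 c.2.1 c.2.2 + c.2.2%:Z).

Lemma interval_codeK (I : int * int) : I.1 <= I.2 -> ~ zitv I 0 ->
  interval_of (interval_code I) = I.
Proof.
case: I => x y /= xy; rewrite /zitv /interval_of /start /= => nz.
have [x0|x0] := boolP (0 < x); first by congr pair; lia.
have y0 : y < 0 by rewrite ltNge; apply/negP => y0; apply: nz; lia.
by congr pair; lia.
Qed.

Lemma aspect_interval c : (aspect R (interval_of c) - 1) ^+ 2 = weight c.2.1 c.2.2.
Proof.
case: c => b [s l] /=.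
have -> : aspect R (interval_of (b, (s, l))) = (s.+1 + l)%:R / s.+1%:R.
  by rewrite /aspect /interval_of /start /=; case: b => /=; congr (_%:R / _%:R); lia.
have s0 : 0 < s.+1%:R :> R by rewrite ltr0n.
by rewrite /weight natrD mulrDl divff ?gt_eqF// addrC addrA addNr add0r.
Qed.

Lemma rectangle_le_total D b M S :
  ((\sum_(s <- iota 0 M) \sum_(l <- iota 0 M) cost D b s l S)%:E <= total D b S)%E.
Proof.
rewrite -sumEFin.
have H : (\sum_(0 <= s < M) \sum_(0 <= l <oo) (cost D b s l S)%:E <= total D b S)%E.
  apply: nneseries_lim_ge => s _ _; apply: nneseries_ge0 => l _ _.
  by rewrite lee_fin cost_ge0.
apply: le_trans H; rewrite /index_iota subn0; apply: lee_sum => s _.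
rewrite -sumEFin.
have := @nneseries_lim_ge _ (fun l => (cost D b s l S)%:E) xpredT 0 M.
rewrite /index_iota subn0; apply => l _ _.
by rewrite lee_fin cost_ge0.
Qed.

(** The intervals of a sequence admissible for D are all heavy, and they are distinct because they
    are nonempty and disjoint. Their series is therefore a sum of distinct terms of the two totals
    and cannot diverge. *)
Lemma not_admissible D S : (total D true S < +oo)%E -> (total D false S < +oo)%E ->
  ~ BM_admissible S D.
Proof.
move=> Tt Tf [I [Iv Itriv Iheavy Ioo]].
pose F (c : bool * (nat * nat)) := cost D c.1 c.2.1 c.2.2 S.
have F0 c : 0 <= F c by exact: cost_ge0.
have FE n : (aspect R (I n) - 1) ^+ 2 = F (interval_code (I n)).
  have [xy nz] := Iv n; have := Iheavy n.
  rewrite -{1 2 3}(interval_codeK xy nz) aspect_interval /interval_of card_trace_zitv card_zitv => H.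
  by rewrite /F /cost /= indicE mem_set ?mulr1.
have cI : injective (fun n => interval_code (I n)).
  move=> m n /= E; have [xy nz] := Iv m; have [xy' nz'] := Iv n.
  apply: (Itriv m n) => //; exists (I m).1.
  by rewrite -(interval_codeK xy' nz') -E (interval_codeK xy nz); split; rewrite /zitv /= lexx xy.
suff : (\sum_(0 <= n <oo) ((aspect R (I n) - 1) ^+ 2)%:E <=
    total D true S + total D false S)%E.
  by rewrite Ioo leNgt lte_add_pinfty.
apply: lime_le.
  by apply: is_cvg_nneseries => i _ _; rewrite lee_fin sqr_ge0.
apply: nearW => N; rewrite big_mkord.
under eq_bigr do rewrite FE.
rewrite sumEFin.
(* A square of codes that contains the first N intervals, whatever their order in the sequence. *)
have [M MP] : exists M, forall n : 'I_N,
    ((interval_code (I n)).2.1 < M)%N /\ ((interval_code (I n)).2.2 < M)%N.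
  exists (\max_(n < N) maxn (interval_code (I n)).2.1 (interval_code (I n)).2.2).+1 => n.
  have := leq_bigmax (F := fun n : 'I_N => maxn (interval_code (I n)).2.1 (interval_code (I n)).2.2) n.
  by rewrite geq_max => /andP[].
pose s1 := [seq interval_code (I (val n)) | n <- enum 'I_N].
pose s2 := [seq (b, p) | b <- [:: true; false],
                        p <- [seq (s, l) | s <- iota 0 M, l <- iota 0 M]].
have us1 : uniq s1.
  by rewrite map_inj_uniq ?enum_uniq// => i j /cI /val_inj.
have sub : {subset s1 <= s2}.
  move=> c /mapP[n _ ->].
  have [] := MP n; case: (interval_code (I n)) => b [s l] /= sM lM.
  apply: allpairs_f; first by case: b.
  by apply: allpairs_f; rewrite mem_iota.
have := ler_sum_subseq F0 us1 sub.
rewrite big_map big_enum /= -lee_fin => /le_trans; apply.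
rewrite /s2 big_allpairs big_cons big_seq1 !big_allpairs EFinD.
by apply: leeD; exact: rectangle_le_total.
Qed.

Lemma admissibleW (S : powZ) (D D' : R) : D' <= D -> BM_admissible S D ->
  BM_admissible S D'.
Proof.
move=> DD [I [I1 I2 I3 I4]]; exists I; split=> // n.
by apply: le_trans (I3 n); rewrite ler_wpM2r.
Qed.

Lemma ae_density_le : {ae P, forall S : borel_powZ, (BM_density R S <= leb R A)%E}.
Proof.
pose D (j : nat) := dens A + j.+1%:R^-1.
have H b j : {ae P, forall S, (total (D j) b S < +oo)%E}.
  by apply: total_lty; rewrite ltrDl invr_gt0.
have : {ae P, forall S, forall j, (total (D j) true S < +oo)%E /\ (total (D j) false S < +oo)%E}.
  apply/ae_foralln => j.
  apply: (negligibleS _ (negligibleU (H true j) (H false j))) => S /=.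
  by move=> /not_andP[]; [left|right].
apply: negligibleS => S /=; apply: contra_not => T.
apply: ge_ereal_sup => _ [E [_ admE] <-]; rewrite (leb_dens mA AT) lee_fin leNgt.
apply/negP => aE; have [j /= jE] := ltr_add_invr aE.
have [Tt Tf] := T j; apply: (not_admissible Tt Tf).
by apply: admissibleW admE; exact: ltW.
Qed.

End Upper.

(** * The lower bound for the density *)

Section Lower.
Variables (R : realType) (A : set (lebesgueType R)) (mA : measurable A).
Hypothesis AT : A `<=` @torus R.
Variable P : probability borel_powZ R.
Hypothesis dP : determinantal (toeplitz A) P.

(** Diminished by 1 as [start] expects of distances and lengths: [dyadic n] is
    [2^n, 2^(n+1) - 1]. *)
Definition pow2 n := (2 ^ n).-1.

Lemma pow2S n : (pow2 n).+1 = (2 ^ n)%N.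
Proof. by rewrite /pow2 prednK ?expn_gt0. Qed.

Definition dyadic n : int * int := interval_of (true, (pow2 n, pow2 n)).

Lemma dyadicE n k : zitv (dyadic n) k <-> (2 ^ n)%:Z <= k < (2 ^ n.+1)%:Z.
Proof.
rewrite /zitv /dyadic /interval_of /start /= pow2S expnS.
have := pow2S n; lia.
Qed.

Lemma dyadic_trivIset : trivIset setT (fun n => zitv (dyadic n)).
Proof.
move=> m n _ _ [k [/dyadicE + /dyadicE]] => /andP[mk km] /andP[nk kn].
have H a b : ((2 ^ a)%:Z <= k) -> (k < (2 ^ b.+1)%:Z) -> (a <= b)%N.
  move=> ak kb; have : (2 ^ a < 2 ^ b.+1)%N by have := le_lt_trans ak kb.
  by rewrite ltn_exp2l.
by apply/eqP; rewrite eqn_leq !H.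
Qed.

(** From n = 1 on, the aspect of the dyadic interval is at least 3/2. The interval at n = 0 is the
    single point 1, of aspect 1, hence the shift by one in the sequences below. *)
Lemma quarter_le_weight n : (0 < n)%N -> 4^-1 <= weight R (pow2 n) (pow2 n).
Proof.
move=> n0; rewrite /weight.
have -> : 4^-1 = 2^-1 ^+ 2 :> R by rewrite exprVn -natrX.
rewrite ler_sqr ?nnegrE ?divr_ge0// ler_pdivlMr// mulrC ler_pdivrMr//.
rewrite -natrM ler_nat pow2S.
by case: n n0 => // n _; rewrite /pow2 expnS; have := expn_gt0 2 n; lia.
Qed.

Lemma sum_ge_pinfty (u : nat -> R) (c : R) : 0 < c -> (forall n, c <= u n) ->
  (\sum_(0 <= n <oo) (u n)%:E = +oo)%E.
Proof.
move=> c0 cu; apply/eqyP => B B0.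
have := archi_boundP (ltW (divr_gt0 B0 c0)); set N := Num.bound _ => HN.
apply: (@le_trans _ _ (\sum_(0 <= n < N) (u n)%:E)%E); last first.
  apply: nneseries_lim_ge => n _ _.
  by rewrite lee_fin; apply: le_trans (cu n); exact: ltW.
rewrite sumEFin lee_fin big_mkord; apply: (@le_trans _ _ (\sum_(i < N) c)).
  by rewrite sumr_const card_ord -mulr_natl -ler_pdivrMr// ltW.
by apply: ler_sum => i _.
Qed.

(** This serves the case |A| = 0, where no D >= 0 lies strictly below |A|, and yet the supremum has
    to be at least 0 rather than that of an empty set. *)
Lemma zero_admissible (S : powZ) : BM_admissible S (0 : R).
Proof.
exists (fun n => dyadic n.+1); split.
- move=> n; split; first by rewrite /dyadic /= lerDl.
  by move=> /dyadicE/andP[+ _]; have := expn_gt0 2 n.+1; lia.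
- move=> m n _ _ H; have := @dyadic_trivIset m.+1 n.+1 I I H; by case.
- by move=> n; rewrite mul0r.
- by apply: (@sum_ge_pinfty _ 4^-1) => // n; rewrite aspect_interval quarter_le_weight.
Qed.

Definition light (D : R) n : set borel_powZ :=
  [set S | #|trace (@iv (2 ^ n)%:Z (pow2 n).+1) S|%:R <= D * (pow2 n).+1%:R].

Lemma eventually_admissible D S : ~ lim_sup_set (light D) S -> BM_admissible S D.
Proof.
move=> nS.
have [N HN] : exists N, forall n, (N <= n)%N -> ~ light D n S.
  apply: contrapT => H; apply: nS => N _; apply: contrapT => H'.
  by apply: H; exists N => n Nn Sn; apply: H'; exists n.
exists (fun n => dyadic (N + n).+1); split.
- move=> n; split; first by rewrite /dyadic /= lerDl.
  by move=> /dyadicE/andP[+ _]; have := expn_gt0 2 (N + n).+1; lia.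
- move=> m n _ _ H; have := @dyadic_trivIset (N + m).+1 (N + n).+1 I I H.
  by move=> [] /addnI.
- move=> n; rewrite /dyadic /interval_of card_trace_zitv card_zitv /= pow2S.
  have /negP := HN (N + n).+1 (leq_trans (leq_addr n N) (leqnSn _)).
  by rewrite -ltNge pow2S => /ltW.
- by apply: (@sum_ge_pinfty _ 4^-1) => // n; rewrite aspect_interval quarter_le_weight.
Qed.

Lemma measurable_light D n : measurable (light D n).
Proof.
exact: (measurable_trace (@iv (2 ^ n)%:Z (pow2 n).+1)
  (fun C => #|C|%:R <= D * (pow2 n).+1%:R)).
Qed.

Lemma ae_admissible D : 0 <= D -> D < dens A -> {ae P, forall S, BM_admissible S D}.
Proof.
move=> D0 Da; have [delta d0 HD] := tail_lower mA AT dP D0 Da.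
pose K := (4 / delta) ^+ 4; have K0 : 0 <= K by rewrite exprn_even_ge0.
have bound n : (P (light D n) <= (K * (n.+1%:R ^+ 2)^-1)%:E)%E.
  apply: (le_trans (HD _ _ (@iv_inj (2 ^ n)%:Z (pow2 n).+1))).
  rewrite lee_fin pow2S.
  have p0 : 0 < (2 ^ n)%:R :> R by rewrite ltr0n expn_gt0.
  have n0 : 0 < n.+1%:R :> R by rewrite ltr0n.
  apply: (@le_trans _ _ ((4 / (delta * (2 ^ n)%:R)) ^+ 4)).
    by rewrite expRN_le// mulr_gt0.
  have -> : (4 / (delta * (2 ^ n)%:R)) ^+ 4 = K * ((2 ^ n)%:R ^+ 4)^-1.
    by rewrite /K; field; rewrite !gt_eqF.
  rewrite ler_wpM2l// lef_pV2 ?posrE ?exprn_gt0//.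
  have np : n.+1%:R <= (2 ^ n)%:R :> R by rewrite ler_nat ltn_expl.
  apply: (@le_trans _ _ ((2 ^ n)%:R ^+ 2)); first by apply: lerXn2r => //; rewrite nnegrE ltW.
  by rewrite ler_weXn2l// ler1n expn_gt0.
have fin : (\sum_(n <oo) P (light D n) < +oo)%E.
  apply: (@le_lt_trans _ _ (K * 2)%:E); last by rewrite ltry.
  apply: (@le_trans _ _ (\sum_(0 <= n <oo) (K * (n.+1%:R ^+ 2)^-1)%:E)%E).
    by apply: lee_nneseries => [n _ _|n _]; [exact: measure_ge0|exact: bound].
  apply: nneseries_le => [n|n]; first by apply: mulr_ge0 => //; rewrite invr_ge0 sqr_ge0.
  by rewrite -mulr_sumr ler_wpM2l// sum_inv_sqr.
have H := lim_sup_set_cvg0 (measurable_light D) fin.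
have mL : measurable (lim_sup_set (light D)).
  apply: bigcap_measurable => [|n _]; first by exists 0%N.
  by apply: bigcup_measurable => k _; exact: measurable_light.
exists (lim_sup_set (light D)); split=> // S /= nS.
by apply: contrapT => /eventually_admissible.
Qed.

Lemma ae_density_ge : {ae P, forall S : borel_powZ, (leb R A <= BM_density R S)%E}.
Proof.
rewrite (leb_dens mA AT).
have a0 := dens_ge0 A; have [a_eq0|a_neq0] := eqVneq (dens A) 0.
  apply: (negligibleS _ (negligible_set0 P)) => S /= nS; apply: nS.
  by rewrite a_eq0; apply: ereal_sup_ubound; exists 0 => //; split=> //; exact: zero_admissible.
have apos : 0 < dens A by rewrite lt_def a_neq0.
(* The gap is proportional to [dens A], which keeps every D j nonnegative, as the definition of the
   density demands. *)
pose D (j : nat) := dens A - dens A / j.+1%:R.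
have D0 j : 0 <= D j.
  by rewrite subr_ge0 ler_pdivrMr// ler_peMr// ler1n.
have H j : {ae P, forall S : borel_powZ, BM_admissible S (D j)}.
  by apply: ae_admissible => //; rewrite gtrBl divr_gt0.
have := ae_foralln H; apply: negligibleS => S /=; apply: contra_not => adm.
apply/lee_addgt0Pr => e e0.
have [j /= jE] := ltr_add_invr (divr_gt0 e0 apos).
have : ((D j)%:E <= BM_density R S)%E.
  by apply: ereal_sup_ubound; exists (D j).
move=> /(leeD (lexx e%:E)); rewrite addeC [X in (_ <= X)%E -> _]addeC; apply: le_trans.
rewrite -EFinD lee_fin /D -addrA lerDl.
move: jE; rewrite add0r => jE; rewrite addrC subr_ge0 mulrC -ler_pdivlMr//.
exact: ltW.
Qed.

End Lower.

(** * Almost sure and sure conclusions *)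

Lemma ae_good_spectrum (R : realType) (A : set (lebesgueType R))
    (mA : measurable A) (AT : A `<=` @torus R) (P : probability borel_powZ R) :
  determinantal (toeplitz A) P -> {ae P, forall S, good_spectrum A S}.
Proof.
move=> dP; have U := ae_uniqueness mA dP.
have Dle := ae_density_le mA AT dP; have Dge := ae_density_ge mA AT dP.
apply: (negligibleS _ (negligibleU U (negligibleU Dle Dge))) => S /=.
apply: contraPP => /not_orP[/contrapT uS /not_orP[/contrapT le /contrapT ge]] []; split=> //.
by apply/eqP; rewrite eq_le le ge.
Qed.

Theorem corollary1p4 (R : realType) (A : set (lebesgueType R))
    (mA : measurable A) (AT : A `<=` @torus R) :
  (exists S : powZ, good_spectrum A S) /\
  (exists P : probability borel_powZ R, determinantal (toeplitz A) P) /\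
  (forall P : probability borel_powZ R, determinantal (toeplitz A) P ->
     {ae P, forall S, good_spectrum A S}).
Proof.
have aeP := @ae_good_spectrum R A mA AT.
have [P dP] : exists P : probability borel_powZ R, determinantal (toeplitz A) P.
  apply: determinantal_exists => [j k|n e c injE]; first exact: toeplitz_herm.
  exact: energy_ge0.
split; last by split=> //; exists P.
(* If no S were good, the exceptional null set would be the whole space, which has probability 1. *)
apply: contrapT => noS; have [N [_ PN0 NS]] := aeP P dP.
have : P setT = 0%E.
  by rewrite -PN0; congr (P _); apply/esym/seteqP; split=> // S _;
     apply: NS => gS; apply: noS; exists S.
by rewrite probability_setT => /eqP; rewrite onee_eq0.
Qed.
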